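(* Let $m_1,m_2,m_3$ be positive integers. The space $\mathbb{R}^{m_1\times m_2\times m_3}$ contains a finite number of open connected pairwise disjoint semi-algebraic sets $O_1,\ldots,O_M$, and there are integers $r_1,\ldots,r_M$, satisfying the following properties. 1. $\mathbb{R}^{m_1\times m_2\times m_3}\setminus \bigcup_{i=1}^M O_i$ is a closed semi-algebraic set in $\mathbb{R}^{m_1\times m_2\times m_3}$ of dimension strictly less than $m_1m_2m_3$. 2. Each $\mathcal{T}\in O_i$ has (real) rank $r_i$, for $i=1,\ldots,M$. 3. $\min(r_1,\ldots,r_M)=\mathrm{grank}(m_1,m_2,m_3)$. 4. $\mathrm{mtrank}(m_1,m_2,m_3):=\max(r_1,\ldots,r_M)$ is the minimal $k\in\mathbb{N}$ such that the closure of $\mathbf{f}_k((\mathbb{R}^{m_1}\times\mathbb{R}^{m_2}\times\mathbb{R}^{m_3})^k)$ is equal to $\mathbb{R}^{m_1\times m_2\times m_3}$. 5. For each integer $r\in[\mathrm{grank}(m_1,m_2,m_3),\mathrm{mtrank}(m_1,m_2,m_3)]$ there exists an integer $i\in[1,M]$ with $r_i=r$.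
   Context: The real rank of a tensor $\mathcal{T}\in\mathbb{R}^{m_1\times m_2\times m_3}$ is the minimal $k$ such that $\mathcal{T}$ is a sum of $k$ tensors $\mathbf{x}\otimes\mathbf{y}\otimes\mathbf{z}$ with $\mathbf{x}\in\mathbb{R}^{m_1},\mathbf{y}\in\mathbb{R}^{m_2},\mathbf{z}\in\mathbb{R}^{m_3}$. The map $\mathbf{f}_k$ is $\mathbf{f}_k(\mathbf{x}_{1,1},\mathbf{x}_{1,2},\mathbf{x}_{1,3},\ldots,\mathbf{x}_{k,1},\mathbf{x}_{k,2},\mathbf{x}_{k,3})=\sum_{l=1}^k\mathbf{x}_{l,1}\otimes\mathbf{x}_{l,2}\otimes\mathbf{x}_{l,3}$, where $\mathbf{x}_{l,j}$ has $m_j$ coordinates. The generic rank $\mathrm{grank}(m_1,m_2,m_3)$ (over $\mathbb{C}$) is the smallest positive integer $k$ for which there exist vectors $\mathbf{x}_{l,j}\in\mathbb{C}^{m_j}$ ($j=1,2,3$, $l=1,\ldots,k$) such that the $k(m_1+m_2+m_3)$ tensors $\mathbf{e}_{i_1,1}\otimes\mathbf{x}_{l,2}\otimes\mathbf{x}_{l,3}$, $\mathbf{x}_{l,1}\otimes\mathbf{e}_{i_2,2}\otimes\mathbf{x}_{l,3}$, $\mathbf{x}_{l,1}\otimes\mathbf{x}_{l,2}\otimes\mathbf{e}_{i_3,3}$ ($i_j=1,\ldots,m_j$, $l=1,\ldots,k$) span $\mathbb{C}^{m_1\times m_2\times m_3}$; here $\mathbf{e}_{1,j},\ldots,\mathbf{e}_{m_j,j}$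 is the standard basis of $\mathbb{C}^{m_j}$. Open, closed, closure refer to the standard Euclidean topology. A semi-algebraic set is a finite union of sets each defined by finitely many real polynomial equations and strict polynomial inequalities; dimension is the semi-algebraic dimension. *)

(* Defs.v *)
From HB Require Import structures.
From mathcomp Require Import all_boot all_order all_algebra.
From mathcomp Require Import all_classical all_reals all_analysis.
From mathcomp Require Import ring_quotient complex.
(* The notations of mpoly clash with those of mathcomp-analysis. *)
From mathcomp Require mpoly.
Import (canonicals) mpoly.

Set Implicit Arguments.
Unset Strict Implicit.
Unset Printing Implicit Defensive.

Import Order.TTheory GRing.Theory Num.Theory.
Import numFieldNormedType.Exports.
Local Open Scope classical_set_scope.
Local Open Scope ring_scope.

(* [is_least P k]: k is the smallest natural number satisfying P.
   [least P] is that number, and 0 when P is never satisfied (which does not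
   happen below, see [tensor_rankP] and [grankP]). *)
Definition is_least (P : nat -> Prop) (k : nat) : Prop :=
  P k /\ forall j, P j -> (k <= j)%N.

Definition least (P : nat -> Prop) : nat := xget 0%N [set k | is_least P k].

Lemma leastP (P : nat -> Prop) (k : nat) : P k -> is_least P (least P).
Proof.
move=> Pk; apply: (xgetPex 0%N (P := [set k | is_least P k])).
have exP : exists k, `[< P k >] by exists k; apply/asboolP.
exists (ex_minn exP); case: ex_minnP => j /asboolP Pj jmin.
by split=> // i Pi; apply: jmin; apply/asboolP.
Qed.

(* F^(m1 x m2 x m3), as row vectors of its m1 * m2 * m3 coordinates, so that it
   inherits the vector space structure and the (product) topology of 'rV. *)
Notation tensor F m1 m2 m3 := 'rV[F]_(m1 * m2 * m3).

Definition tentry (F : Type) (m1 m2 m3 : nat) (T : tensor F m1 m2 m3)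
    (i : 'I_m1) (j : 'I_m2) (k : 'I_m3) : F :=
  T 0 (mxvec_index (mxvec_index i j) k).

Definition outer (F : fieldType) (m1 m2 m3 : nat)
    (x : 'rV[F]_m1) (y : 'rV[F]_m2) (z : 'rV[F]_m3) : tensor F m1 m2 m3 :=
  mxvec ((mxvec (x^T *m y))^T *m z).

Lemma outerE (F : fieldType) (m1 m2 m3 : nat)
    (x : 'rV[F]_m1) (y : 'rV[F]_m2) (z : 'rV[F]_m3) i j k :
  tentry (outer x y z) i j k = x 0 i * y 0 j * z 0 k.
Proof. by rewrite /tentry mxvecE mxE big_ord1 mxE mxvecE mxE big_ord1 mxE. Qed.

Definition rank_one_sum (F : fieldType) (m1 m2 m3 k : nat)
    (x : 'I_k -> 'rV[F]_m1 * 'rV[F]_m2 * 'rV[F]_m3) : tensor F m1 m2 m3 :=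
  \sum_(l < k) outer (x l).1.1 (x l).1.2 (x l).2.

Definition tensor_rank (F : fieldType) (m1 m2 m3 : nat)
    (T : tensor F m1 m2 m3) : nat :=
  least (fun k => range (@rank_one_sum F m1 m2 m3 k) T).

Definition tangent_family (F : fieldType) (m1 m2 m3 k : nat)
    (x : 'I_k -> 'rV[F]_m1 * 'rV[F]_m2 * 'rV[F]_m3) :
    seq (tensor F m1 m2 m3) :=
  [seq outer (delta_mx 0 i) (x l).1.2 (x l).2
     | l <- enum 'I_k, i <- enum 'I_m1] ++
  [seq outer (x l).1.1 (delta_mx 0 i) (x l).2
     | l <- enum 'I_k, i <- enum 'I_m2] ++
  [seq outer (x l).1.1 (x l).1.2 (delta_mx 0 i)
     | l <- enum 'I_k, i <- enum 'I_m3].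

Definition grank (F : fieldType) (m1 m2 m3 : nat) : nat :=
  least (fun k => (0 < k)%N /\
    exists x : 'I_k -> 'rV[F]_m1 * 'rV[F]_m2 * 'rV[F]_m3,
      <<tangent_family x>>%VS = fullv).

Section Existence.
Variables (F : fieldType) (m1 m2 m3 : nat).

Let J := ('I_m1 * 'I_m2 * 'I_m3)%type.

Let basis_triple (p : J) : 'rV[F]_m1 * 'rV[F]_m2 * 'rV[F]_m3 :=
  (delta_mx 0 p.1.1, delta_mx 0 p.1.2, delta_mx 0 p.2).

Let outer_delta (p : J) :
  outer (basis_triple p).1.1 (basis_triple p).1.2 (basis_triple p).2 =
  delta_mx 0 (mxvec_index (mxvec_index p.1.1 p.1.2) p.2) :> tensor F m1 m2 m3.
Proof.
rewrite /outer /= -(mxvec_delta F (mxvec_index p.1.1 p.1.2) p.2); congr mxvec.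
have -> : (delta_mx 0 p.1.1 : 'rV[F]_m1)^T *m (delta_mx 0 p.1.2 : 'rV[F]_m2) =
          delta_mx p.1.1 p.1.2.
  by rewrite trmx_delta mul_delta_mx.
by rewrite mxvec_delta trmx_delta mul_delta_mx.
Qed.

Let outerZ (a : F) x y z :
  outer (a *: x) y z = a *: outer x y z :> tensor F m1 m2 m3.
Proof. by rewrite /outer !linearZ /= -!scalemxAl !linearZ /= -!scalemxAl linearZ. Qed.

Let index3P (q : 'I_(m1 * m2 * m3)) :
  exists p : J, q = mxvec_index (mxvec_index p.1.1 p.1.2) p.2.
Proof.
by case/mxvec_indexP: q => s k; case/mxvec_indexP: s => i j; exists (i, j, k).
Qed.

Let pick_triple (q : 'I_(m1 * m2 * m3)) : J := sval (cid (index3P q)).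

Let outer_pick q :
  outer (basis_triple (pick_triple q)).1.1 (basis_triple (pick_triple q)).1.2
    (basis_triple (pick_triple q)).2 = delta_mx 0 q :> tensor F m1 m2 m3.
Proof. by rewrite outer_delta -(svalP (cid (index3P q))). Qed.

Lemma tensor_rankP (T : tensor F m1 m2 m3) :
  is_least (fun k => range (@rank_one_sum F m1 m2 m3 k) T) (tensor_rank T).
Proof.
apply: (@leastP _ (m1 * m2 * m3)%N).
pose b q := basis_triple (pick_triple q).
exists (fun q => (T 0 q *: (b q).1.1, (b q).1.2, (b q).2)) => //.
rewrite /rank_one_sum [RHS]row_sum_delta; apply: eq_bigr => q _ /=.
by rewrite outerZ outer_pick.
Qed.

Lemma grankP : (0 < m1)%N -> (0 < m2)%N -> (0 < m3)%N ->
  is_least (fun k => (0 < k)%N /\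
    exists x : 'I_k -> 'rV[F]_m1 * 'rV[F]_m2 * 'rV[F]_m3,
      <<tangent_family x>>%VS = fullv) (grank F m1 m2 m3).
Proof.
move=> m1_gt0 m2_gt0 m3_gt0; apply: (@leastP _ (m1 * m2 * m3)%N).
split; first by rewrite !muln_gt0 m1_gt0 m2_gt0.
exists (fun q => basis_triple (pick_triple q)).
apply/eqP; rewrite eqEsubv subvf /=; apply/subvP => T _.
rewrite [T]row_sum_delta; apply: memv_suml => q _; apply: memvZ.
apply: memv_span; rewrite /tangent_family mem_cat; apply/orP; left.
apply/allpairsP; exists (q, (pick_triple q).1.1).
by rewrite !mem_enum; split=> //=; rewrite -[LHS]outer_pick.
Qed.

End Existence.

Section SemiAlgebraic.
Variables (R : realType) (n : nat).
Local Notation poly_n := (mpoly.mpoly n R).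

Definition peval (p : poly_n) (x : 'rV[R]_n) : R := mpoly.meval (x 0) p.

(* The points where the polynomials in b.1 vanish and those in b.2 are > 0. *)
Definition basic_semialgebraic (b : seq poly_n * seq poly_n) : set 'rV[R]_n :=
  [set x | (forall p, p \in b.1 -> peval p x = 0) /\
           (forall q, q \in b.2 -> 0 < peval q x)].

Definition semialgebraic (A : set 'rV[R]_n) : Prop :=
  exists s : seq (seq poly_n * seq poly_n),
    A = \bigcup_(b in [set` s]) basic_semialgebraic b.

(* Bochnak-Coste-Roy, Real Algebraic Geometry, Definition 2.8.1: the dimension
   of A is the Krull dimension of its ring of polynomial functions
   R[X_1, ..., X_n] / I(A).  The primes of this quotient are represented by the
   primes of R[X_1, ..., X_n] containing I(A). *)
Definition vanishing_ideal (A : set 'rV[R]_n) : set poly_n :=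
  [set p | forall x, A x -> peval p x = 0].

Definition prime_chain (A : set 'rV[R]_n) (d : nat) : Prop :=
  exists P : 'I_d.+1 -> prime_idealr poly_n,
    (forall i p, vanishing_ideal A p -> p \in P i) /\
    (forall i j : 'I_d.+1, (i < j)%N ->
       {subset P i <= P j} /\ ~ {subset P j <= P i}).

(* As a supremum in \bar R, it is -oo for the empty set. *)
Definition sa_dim (A : set 'rV[R]_n) : \bar R :=
  ereal_sup [set (d%:R)%:E | d in prime_chain A].

End SemiAlgebraic.

(* Main.v *)
From HB Require Import structures.
Require Import Defs.
From mathcomp Require Import all_boot all_order all_algebra.
From mathcomp Require Import all_classical all_reals all_analysis.
From mathcomp Require Import ring_quotient complex ring lra.
From mathcomp Require mpoly qe_rcf ordered_qelim.
Import -(notations) mpoly.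

Set Implicit Arguments.
Unset Strict Implicit.
Unset Printing Implicit Defensive.

Import Order.TTheory GRing.Theory Num.Theory.
Import numFieldNormedType.Exports.
Local Open Scope classical_set_scope.
Local Open Scope ring_scope.

(** Let F_k be the polynomial map of [rank_poly], whose image E_k is the set of
    real tensors of rank at most k.  Three facts carry the proof.

    Genericity.  A semialgebraic set is, away from the zero set of some nonzero
    polynomial, locally constant: a point and its neighbours are all inside or
    all outside ([sa_generic]).  The sets E_k are semialgebraic by the
    Tarski-Seidenberg theorem ([sa_proj]) and E_k is everything for
    k = m1 m2 m3, so the rank is locally constant where one nonzero polynomial f
    does not vanish.

    Cells.  For every nonzero f there are finitely many disjoint open connected
    semialgebraic sets inside the locus where f is nonzero, covering the locus
    where another nonzero polynomial h is nonzero ([cell_decomposition]).  This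
    is the open part of a cylindrical decomposition, by induction on the number
    of variables: above a cell of the base the line is cut at the real roots of
    f.  Over a generic base point the bands between consecutive roots are open,
    by the genericity principle at all rational heights and the Baire category
    theorem ([band_interior_generic]).  On each cell the rank is constant, and
    the cells are dense.  Their complement lies in the zero set of h; it has
    dimension smaller than m1 m2 m3 because m + 1 polynomials in m variables are
    algebraically dependent, which bounds the length of chains of primes
    ([sa_dim_lt]).

    Jacobian criterion in characteristic zero.  The coordinates of F_k are
    algebraically independent exactly when its Jacobian has full row rank at some
    point ([algebraic_dependence_of_jacobian],
    [algebraic_independence_of_jacobian]), and the columns of the Jacobian are
    the tangent tensors that define grank ([row_free_tangent]).  If a cell has
    rank k then E_k has interior points, so no nonzero polynomial vanishes on it
    and grank <= k ([grank_le_of_interior]).  Conversely for k = grank no nonzero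
    polynomial vanishes on E_k, so by genericity E_k has interior points and
    meets a cell ([rank_set_grank_interior]).

    The statements on the maximal rank follow from the density of the cells.  If
    some value s between the extremes were not attained, the closure of the union
    of the cells of rank less than s would be stable under the addition of rank
    one tensors, hence would be the whole space, and no cell could have rank more
    than s ([rank_jump]). *)

Local Notation mX i := (mpolyX _ (mnm1 i)).
Local Notation mcomp F := (mmap (@mpolyC _ _) F).

(* Keeps failing unifications from unfolding polynomials into sums. *)
Local Opaque mmap mderiv.

(** * Polynomial rings, composition and slices *)

Section PolynomialRing.
Variables (K : numFieldType).

Lemma mpoly_ring_ind n (S : mpoly n K -> Prop) :
  (forall c, S (mpolyC n c)) -> (forall i, S (mX i)) ->
  (forall p q, S p -> S q -> S (p + q)) ->
  (forall p q, S p -> S q -> S (p * q)) -> forall p, S p.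
Proof.
move=> SC SX SD SM p; rewrite [p]mpolyE.
elim/big_rec: _ => [|m q _ Sq]; first by rewrite -(mpolyC0 n K).
apply: (SD) => //; rewrite -mul_mpolyC; apply: (SM) => //.
rewrite mpolyXE_id; elim/big_rec: _ => [|i r _ Sr]; first by rewrite -(mpolyC1 n K).
apply: (SM) => //; elim: (m i) => [|k IH]; first by rewrite expr0 -(mpolyC1 n K).
by rewrite exprS; apply: SM.
Qed.

Lemma mpoly_rmorph_ext n (A : comNzRingType) (f g : {rmorphism mpoly n K -> A}) :
  (forall c, f (mpolyC n c) = g (mpolyC n c)) ->
  (forall i, f (mX i) = g (mX i)) -> f =1 g.
Proof.
move=> fgC fgX; apply: mpoly_ring_ind => // p q eqp eqq.
  by rewrite !rmorphD eqp eqq.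
by rewrite !rmorphM eqp eqq.
Qed.

Lemma mmapXU n (A : comNzRingType) (f : {rmorphism K -> A}) (h : 'I_n -> A) i :
  mmap f h (mX i) = h i.
Proof. by rewrite mmapX mmap1U. Qed.

Lemma meval_mcomp n N (F : 'I_N -> mpoly n K) (x : 'I_n -> K) P :
  meval x (mcomp F P) = meval (fun j => meval x (F j)) P.
Proof.
elim/mpoly_ring_ind: P => [c|i|p q IHp IHq|p q IHp IHq].
- by rewrite mmapC !mevalC.
- by rewrite mmapXU mevalXU.
- by rewrite rmorphD !mevalD IHp IHq.
- by rewrite rmorphM !mevalM IHp IHq.
Qed.

Lemma mderiv_mcomp n N (F : 'I_N -> mpoly n K) k P :
  mderiv k (mcomp F P) = \sum_j mcomp F (mderiv j P) * mderiv k (F j).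
Proof.
elim/mpoly_ring_ind: P => [c|i|p q IHp IHq|p q IHp IHq].
- rewrite mmapC mderivC big1 // => j _.
  by rewrite mderivC rmorph0 mul0r.
- rewrite mmapXU (bigD1 i) //= big1 ?addr0 => [|j ji].
    by rewrite mderivX mnm1E eqxx scale1r -{1}[mnm1 i]add0m addmK mpolyX0 rmorph1 mul1r.
  by rewrite mderivX mnm1E eq_sym (negbTE ji) scale0r rmorph0 mul0r.
- rewrite rmorphD /= mderivD IHp IHq -big_split; apply: eq_bigr => j _ /=.
  by rewrite mderivD rmorphD mulrDl.
- rewrite rmorphM /= mderivM IHp IHq mulr_suml mulr_sumr -big_split.
  apply: eq_bigr => j _ /=; rewrite mderivM mmapD !rmorphM /=; ring.
Qed.

Lemma mderiv_eq0_const n (P : mpoly n K) :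
  (forall j, mderiv j P = 0) -> P = mpolyC n (mcoeff mnm0 P).
Proof.
move=> dP; apply/mpolyP => m; rewrite mcoeffC.
have [->|m0] := eqVneq m mnm0; first by rewrite mulr1.
rewrite mulr0; have [i mi] : exists i, (m i != 0)%N.
  apply/existsP; apply: contraNT m0; rewrite negb_exists => /forallP m0.
  by apply/eqP/mnmP => i; rewrite mnm0E; apply/eqP; move: (m0 i); rewrite negbK.
have := mcoeff_deriv i (mnm_sub m (mnm1 i)) P.
rewrite dP mcoeff0 submK ?lep1mP // => /esym/eqP.
by rewrite mulrn_eq0 /= => /eqP.
Qed.

Lemma msize_mderiv n j (P : mpoly n K) :
  P != 0 -> (mmeasure mdeg (mderiv j P) < mmeasure mdeg P)%N.
Proof.
move=> P0; have [->|dP0] := eqVneq (mderiv j P) 0.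
  by rewrite mmeasure0 lt0n mmeasure_poly_eq0.
rewrite -(mlead_deg dP0); have := mlead_supp dP0.
rewrite mcoeff_msupp mcoeff_deriv mulrn_eq0 negb_or /= -mcoeff_msupp.
by move=> /msize_mdeg_lt; rewrite mdegD mdeg1 addn1.
Qed.

Section Slice.
Variables (n : nat) (k : 'I_n.+1).

(** The point of the hyperplane [x_k = c] whose other coordinates are x. *)
Definition slice_point (T : Type) (c : T) (x : 'I_n -> T) (i : 'I_n.+1) : T :=
  if unlift k i is Some j then x j else c.

Lemma slice_pointk T (c : T) x : slice_point c x k = c.
Proof. by rewrite /slice_point unlift_none. Qed.

Lemma slice_point_lift T (c : T) x j : slice_point c x (lift k j) = x j.
Proof. by rewrite /slice_point liftK. Qed.

Lemma slice_pointP T (x : 'I_n.+1 -> T) : slice_point (x k) (x \o lift k) =1 x.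
Proof. by move=> i; rewrite /slice_point; case: unliftP => [j ->|->]. Qed.

(** Restriction to the hyperplane [x_k = c].  Locked, like the next three
    morphisms, so that unification never unfolds it. *)
Definition slice (c : K) : mpoly n.+1 K -> mpoly n K :=
  locked (mcomp (slice_point (mpolyC n c) (fun j => mX j))).

Fact slice_zmod_morphism (c : K) : zmod_morphism (slice c).
Proof. by rewrite /slice -lock; exact: raddfB. Qed.

Fact slice_monoid_morphism (c : K) : monoid_morphism (slice c).
Proof. by rewrite /slice -lock; split; [exact: rmorph1 | exact: rmorphM]. Qed.

HB.instance Definition _ (c : K) :=
  GRing.isZmodMorphism.Build (mpoly n.+1 K) (mpoly n K) (slice c) (slice_zmod_morphism c).
HB.instance Definition _ (c : K) :=
  GRing.isMonoidMorphism.Build (mpoly n.+1 K) (mpoly n K) (slice c) (slice_monoid_morphism c).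

Lemma sliceC c a : slice c (mpolyC _ a) = mpolyC _ a.
Proof. by rewrite /slice -lock mmapC. Qed.

Lemma sliceX c i : slice c (mX i) = slice_point (mpolyC n c) (fun j => mX j) i.
Proof. by rewrite /slice -lock mmapXU. Qed.

Definition mlift : mpoly n K -> mpoly n.+1 K :=
  locked (mcomp (fun j => mX (lift k j))).

Fact mlift_zmod_morphism : zmod_morphism (mlift).
Proof. by rewrite /mlift -lock; exact: raddfB. Qed.

Fact mlift_monoid_morphism : monoid_morphism (mlift).
Proof. by rewrite /mlift -lock; split; [exact: rmorph1 | exact: rmorphM]. Qed.

HB.instance Definition _ :=
  GRing.isZmodMorphism.Build (mpoly n K) (mpoly n.+1 K) (mlift) (mlift_zmod_morphism).
HB.instance Definition _ :=
  GRing.isMonoidMorphism.Build (mpoly n K) (mpoly n.+1 K) (mlift) (mlift_monoid_morphism).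

Lemma mliftC a : mlift (mpolyC _ a) = mpolyC _ a.
Proof. by rewrite /mlift -lock mmapC. Qed.

Lemma mliftX i : mlift (mX i) = mX (lift k i).
Proof. by rewrite /mlift -lock mmapXU. Qed.

(** A polynomial seen as a univariate polynomial in the variable k, and back: this
    gives access to the theory of roots and multiplicities over an integral
    domain. *)
Definition to_upoly : mpoly n.+1 K -> {poly mpoly n K} :=
  locked (mmap (polyC \o @mpolyC n K) (slice_point 'X (fun j => (mX j)%:P))).

Fact to_upoly_zmod_morphism : zmod_morphism (to_upoly).
Proof. by rewrite /to_upoly -lock; exact: raddfB. Qed.

Fact to_upoly_monoid_morphism : monoid_morphism (to_upoly).
Proof. by rewrite /to_upoly -lock; split; [exact: rmorph1 | exact: rmorphM]. Qed.

HB.instance Definition _ :=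
  GRing.isZmodMorphism.Build (mpoly n.+1 K) ({poly mpoly n K}) (to_upoly) (to_upoly_zmod_morphism).
HB.instance Definition _ :=
  GRing.isMonoidMorphism.Build (mpoly n.+1 K) ({poly mpoly n K}) (to_upoly) (to_upoly_monoid_morphism).

Lemma to_upolyC a : to_upoly (mpolyC _ a) = (mpolyC _ a)%:P.
Proof. by rewrite /to_upoly -lock mmapC. Qed.

Lemma to_upolyX i : to_upoly (mX i) = slice_point 'X (fun j => (mX j)%:P) i.
Proof. by rewrite /to_upoly -lock mmapXU. Qed.

Definition of_upoly : {poly mpoly n K} -> mpoly n.+1 K :=
  locked (horner_eval (mX k) \o map_poly mlift).

Fact of_upoly_zmod_morphism : zmod_morphism (of_upoly).
Proof. by rewrite /of_upoly -lock; exact: raddfB. Qed.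

Fact of_upoly_monoid_morphism : monoid_morphism (of_upoly).
Proof. by rewrite /of_upoly -lock; split; [exact: rmorph1 | exact: rmorphM]. Qed.

HB.instance Definition _ :=
  GRing.isZmodMorphism.Build ({poly mpoly n K}) (mpoly n.+1 K) (of_upoly) (of_upoly_zmod_morphism).
HB.instance Definition _ :=
  GRing.isMonoidMorphism.Build ({poly mpoly n K}) (mpoly n.+1 K) (of_upoly) (of_upoly_monoid_morphism).

Lemma of_upolyE p : of_upoly p = (map_poly mlift p).[mX k].
Proof. by rewrite /of_upoly -lock. Qed.

Lemma to_upolyK : cancel to_upoly of_upoly.
Proof.
elim/mpoly_ring_ind => [c|i|p q IHp IHq|p q IHp IHq].
- by rewrite to_upolyC of_upolyE map_polyC hornerC /= mliftC.
- rewrite to_upolyX /slice_point; case: unliftP => [j ->|->].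
    by rewrite of_upolyE map_polyC hornerC /= mliftX.
  by rewrite of_upolyE map_polyX hornerX.
- by rewrite !rmorphD /= IHp IHq.
- by rewrite !rmorphM /= IHp IHq.
Qed.

Lemma sliceE c p : slice c p = (to_upoly p).[mpolyC n c].
Proof.
elim/mpoly_ring_ind: p => [a|i|p q IHp IHq|p q IHp IHq].
- by rewrite sliceC to_upolyC hornerC.
- rewrite sliceX to_upolyX /slice_point; case: unliftP => [j|] _.
    by rewrite hornerC.
  by rewrite hornerX.
- by rewrite !rmorphD hornerD /= IHp IHq.
- by rewrite !rmorphM hornerM /= IHp IHq.
Qed.

Lemma mliftK c : cancel mlift (slice c).
Proof.
apply: (@mpoly_rmorph_ext _ _ (slice c \o mlift) idfun) => [a|i] /=.
  by rewrite mliftC sliceC.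
by rewrite mliftX sliceX slice_point_lift.
Qed.

Lemma slice_of_upoly c p : slice c (of_upoly p) = p.[mpolyC n c].
Proof.
rewrite of_upolyE -horner_map /= -map_poly_comp /=.
by rewrite sliceX slice_pointk map_poly_id // => a _; exact: mliftK.
Qed.

Lemma meval_slice c p (x : 'I_n -> K) :
  meval x (slice c p) = meval (slice_point c x) p.
Proof.
rewrite /slice -lock meval_mcomp; apply: meval_eq => i; rewrite /slice_point.
by case: unlift => [j|]; rewrite ?mevalXU ?mevalC.
Qed.

Lemma mderiv_slice c p j : mderiv j (slice c p) = slice c (mderiv (lift k j) p).
Proof.
rewrite /slice -lock mderiv_mcomp (bigD1 (lift k j)) //= slice_point_lift big1 => [|i il].
  by rewrite addr0 mderivX mnm1E eqxx scale1r -{1}[mnm1 j]add0m addmK mpolyX0 mulr1.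
rewrite /slice_point; case: unliftP => [j' ij'|_]; last by rewrite mderivC mulr0.
rewrite mderivX mnm1E (_ : (j' == j) = false) ?scale0r ?mulr0 //.
by apply: contraNF il => /eqP <-; rewrite ij'.
Qed.

Lemma slice_mcomp N c (F : 'I_N -> mpoly n.+1 K) P :
  slice c (mcomp F P) = mcomp (fun j => slice c (F j)) P.
Proof.
apply: (@mpoly_rmorph_ext _ _ (slice c \o mcomp F) (mcomp (fun j => slice c (F j)))).
  by move=> a; rewrite /= !mmapC sliceC.
by move=> i; rewrite /= !mmapXU.
Qed.

(** The exponent m is the order of vanishing of G along the hyperplane, that is the
    multiplicity of the constant c as a root of the univariate form of G. *)
Lemma factor_hyperplane c G : G != 0 ->
  exists m H, slice c H != 0 /\ G = H * (mX k - mpolyC _ c) ^+ m.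
Proof.
move=> G0; have G0' : to_upoly G != 0.
  by apply: contraNneq G0 => G0; rewrite -[G]to_upolyK G0 rmorph0.
have [m [q]] := multiplicity_XsubC (to_upoly G) (mpolyC n c).
rewrite G0' /= => qc Gq; exists m, (of_upoly q); split; first by rewrite slice_of_upoly.
rewrite -[LHS]to_upolyK Gq rmorphM rmorphXn rmorphB /=; congr (_ * (_ - _) ^+ _).
  by rewrite of_upolyE map_polyX hornerX.
by rewrite of_upolyE map_polyC hornerC /= mliftC.
Qed.

Lemma slice_hyperplane c : slice c (mX k - mpolyC _ c) = 0.
Proof. by rewrite rmorphB /= sliceX sliceC slice_pointk subrr. Qed.

(** What the restriction to [x_k = 0] loses is a multiple of the variable k, so it
    vanishes modulo any ideal that contains the value of that variable. *)
Lemma sub_mlift_slice p : exists q, p - mlift (slice 0 p) = q * mX k.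
Proof.
elim/mpoly_ring_ind: p => [a|i|p q [u Hu] [v Hv]|p q [u Hu] [v Hv]].
- by exists 0; rewrite sliceC mliftC subrr mul0r.
- rewrite sliceX /slice_point; case: unliftP => [j ->|->].
    by exists 0; rewrite mliftX subrr mul0r.
  by exists 1; rewrite mliftC mpolyC0 subr0 mul1r.
- by exists (u + v); rewrite !rmorphD /= opprD addrACA Hu Hv mulrDl.
- exists (u * q + mlift (slice 0 p) * v).
  by rewrite !rmorphM /= mulrDl mulrAC -Hu -mulrA -Hv mulrBl mulrBr addrA subrK.
Qed.

End Slice.

(** A nonzero polynomial has finitely many roots, so it misses some term of any
    injective sequence. *)
Lemma infinite_nonroot (A : idomainType) (u : nat -> A) (p : {poly A}) :
  injective u -> p != 0 -> exists i, p.[u i] != 0.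
Proof.
move=> u_inj p0; apply: contrapT => rootp.
have allr : all (root p) (map u (iota 0 (size p))).
  apply/allP => _ /mapP[i _ ->]; apply/negPn/negP => npi; apply: rootp.
  by exists i.
have us : uniq (map u (iota 0 (size p))) by rewrite map_inj_uniq ?iota_uniq.
by have := max_poly_roots p0 allr us; rewrite size_map size_iota ltnn.
Qed.

Lemma natr_inj : injective (fun m : nat => m%:R : K).
Proof. by move=> a b /eqP; rewrite eqr_nat => /eqP. Qed.

(** One variable is specialised at a time, to a natural number that is not a root
    of the univariate form. *)
Lemma meval_neq0 n (p : mpoly n K) : p != 0 -> exists x, meval x p != 0.
Proof.
elim: n p => [|n IHn] p p0.
  by exists (fun _ => 0); move: p0; rewrite [p]nvar0_mpolyC mevalC mpolyC_eq0.
have p0' : to_upoly ord0 p != 0.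
  by apply: contraNneq p0 => p0; rewrite -(to_upolyK ord0 p) p0 rmorph0.
have inj : injective (fun m => mpolyC n (m%:R : K)).
  by move=> a b /eqP; rewrite mpolyC_eq => /eqP /natr_inj.
have [c] := infinite_nonroot inj p0'; rewrite -sliceE => /IHn[x xP].
by exists (slice_point ord0 c%:R x); rewrite -meval_slice.
Qed.

End PolynomialRing.

(** * More polynomials than variables are algebraically dependent *)

Section Counting.
Variable K : numFieldType.

Lemma msize_prodS n (p q : mpoly n K) a b :
  (mmeasure mdeg p <= a.+1 -> mmeasure mdeg q <= b.+1 ->
   mmeasure mdeg (p * q) <= (a + b).+1)%N.
Proof.
move=> pa qb; have [->|p0] := eqVneq p 0; first by rewrite mul0r mmeasure0.
have [->|q0] := eqVneq q 0; first by rewrite mulr0 mmeasure0.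
rewrite msizeM // -ltnS prednK ?ltnS; last by rewrite addn_gt0 lt0n mmeasure_poly_eq0 p0.
by apply: leq_trans (leq_add pa qb) _; rewrite addSn addnS.
Qed.

Lemma msize_monomial_image n N (F : 'I_N -> mpoly n K) (a : 'I_N -> nat) e D :
  (forall j, mmeasure mdeg (F j) <= e.+1)%N -> (forall j, a j <= D)%N ->
  (mmeasure mdeg (\prod_j F j ^+ a j) <= (N * (D * e)).+1)%N.
Proof.
move=> Fe aD.
have FX j : (mmeasure mdeg (F j ^+ a j) <= (D * e).+1)%N.
  have : (mmeasure mdeg (F j ^+ a j) <= (a j * e).+1)%N.
    elim: (a j) => [|k IH]; first by rewrite expr0 msize1.
    by rewrite exprS mulSn; apply: msize_prodS.
  by move=> /leq_trans; apply; rewrite ltnS leq_mul2r aD orbT.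
have -> : (N * (D * e) = \sum_(j < N) D * e)%N by rewrite sum_nat_const card_ord.
elim/big_rec2: _ => [|j s p _ IH]; first by rewrite msize1.
exact: msize_prodS.
Qed.

Lemma row_dependent m p (A : 'M[K]_(m, p)) :
  (p < m)%N -> exists2 u : 'rV[K]_m, u != 0 & u *m A = 0.
Proof.
move=> pm; have kA : kermx A != 0.
  by rewrite kermx_eq0 /row_free neq_ltn (leq_ltn_trans (rank_leq_col A) pm).
case/rowV0Pn: kA => u /sub_kermxP uA u0; by exists u.
Qed.

(** The monomials with exponents at most D in the F_j are (D + 1)^N many, and they
    lie in a space of dimension O(D^n) with n < N; for D large this forces a linear
    relation between them. *)
Lemma algebraic_dependence n N (F : 'I_N -> mpoly n K) :
  (n < N)%N -> exists2 P : mpoly N K, P != 0 & mcomp F P = 0.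
Proof.
move=> nN; pose e := (\max_j mmeasure mdeg (F j))%N.
(* [b] bounds the degree of the monomials in the F_j with exponents at most
   [D], and [D] is so large that [b ^ n < D.+1 ^ N]. *)
pose D := ((N * e).+1 ^ n)%N; pose b := (N * (D * e)).+1.
have D0 : (0 < D)%N by rewrite expn_gt0.
have bD : (b ^ n < D.+1 ^ N)%N.
  have leX x y : (x <= y -> x ^ n <= y ^ n)%N.
    by move=> xy; elim: (n) => // m IH; rewrite !expnS leq_mul.
  have bDe : (b <= D * (N * e).+1)%N.
    by rewrite /b mulnCA mulnS -[X in (X <= _)%N]add1n leq_add2r.
  apply: leq_ltn_trans (leX _ _ bDe) _.
  rewrite expnMn -expnSr; apply: (@leq_ltn_trans (D ^ N)); first exact: leq_pexp2l.
  by rewrite ltn_exp2r // (leq_ltn_trans _ nN).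
pose I := {ffun 'I_N -> 'I_D.+1}; pose J := {ffun 'I_n -> 'I_b}.
pose mon (a : I) : multinom N := Multinom [tuple (a i : nat) | i < N].
have monE a i : mon a i = a i by exact: mnmE.
have mon_inj : injective mon.
  move=> a a' /mnmP aa'; apply/ffunP => i; apply: val_inj => /=.
  by rewrite -!monE aa'.
pose Fa a := mcomp F (mpolyX K (mon a)).
have FaE a : Fa a = \prod_j F j ^+ a j.
  by rewrite /Fa mmapX; apply: eq_bigr => i _; rewrite monE.
have Fa_size a : (mmeasure mdeg (Fa a) <= b)%N.
  rewrite FaE; apply: msize_monomial_image => j; last by rewrite -ltnS.
  by apply: leqW; exact: (leq_bigmax j).
pose A : 'M[K]_(#|I|, #|J|) := \matrix_(i, j)
  mcoeff (Multinom [tuple ((enum_val j : J) k : nat) | k < n]) (Fa (enum_val i)).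
have [|u u0 uA] := @row_dependent #|I| #|J| A; first by rewrite !card_ffun !card_ord.
pose P := \sum_i u 0 i *: mpolyX K (mon (enum_val i)).
have coefP i : mcoeff (mon (enum_val i)) P = u 0 i.
  rewrite /P raddf_sum (bigD1 i) //= big1 ?addr0 => [|j ji].
    by rewrite mcoeffZ mcoeffX eqxx mulr1.
  rewrite mcoeffZ mcoeffX (_ : (_ == _) = false) ?mulr0 //.
  by apply: contraNF ji => /eqP /mon_inj /enum_val_inj ->.
exists P.
  apply: contraNneq u0 => P0; apply/eqP/rowP => i.
  by rewrite -coefP P0 mcoeff0 mxE.
have PF : mcomp F P = \sum_i u 0 i *: Fa (enum_val i).
  by rewrite /P raddf_sum; apply: eq_bigr => i _; rewrite /= mmapZ mul_mpolyC.
apply/mpolyP => m; rewrite PF raddf_sum mcoeff0 /=.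
have [mb|mb] := ltnP (mdeg m) b; last first.
  apply: big1 => i _; rewrite mcoeffZ memN_msupp_eq0 ?mulr0 //.
  by apply: msize_mdeg_ge; apply: leq_trans mb.
have mib i : (m i < b)%N.
  by apply: leq_ltn_trans mb; rewrite mdegE (bigD1 i) //= leq_addr.
pose j : J := [ffun i => Ordinal (mib i)].
have /rowP/(_ (enum_rank j)) := uA; rewrite !mxE => uAj; rewrite -[RHS]uAj.
apply: eq_bigr => i _; rewrite mcoeffZ mxE enum_rankK; congr (_ * mcoeff _ _).
by apply/mnmP => k; rewrite mnmE ffunE.
Qed.

End Counting.

(** * The Jacobian criterion *)

Lemma fraction_numden (A : idomainType) (x : {fraction A}) :
  exists n d : A, d != 0 /\ x * tofrac d = tofrac n.
Proof.
elim/quotW: x => r; exists (frac r).1, (frac r).2; split; first exact: denom_ratioP.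
change (FracField.mul (\pi_(FracField.type A) r)%qT (tofrac (frac r).2) = tofrac (frac r).1).
rewrite !piE; apply/eqmodP => /=.
rewrite FracField.equivfE /FracField.mulf !numden_Ratio ?mulr1 ?oner_eq0 ?denom_ratioP //.
by rewrite mulrC.
Qed.

Lemma clear_denominators (A : idomainType) m p (B : 'M[{fraction A}]_(m, p)) :
  exists (d : A) (C : 'M[A]_(m, p)), d != 0 /\ tofrac d *: B = map_mx (@tofrac A) C.
Proof.
have numP i j : exists nd : A * A, nd.2 != 0 /\ B i j * tofrac nd.2 = tofrac nd.1.
  by have [a [b ab]] := fraction_numden (B i j); exists (a, b).
pose nd i j := sval (cid (numP i j)).
have nd2 i j : (nd i j).2 != 0 by have [] := svalP (cid (numP i j)).
have ndB i j : B i j * tofrac (nd i j).2 = tofrac (nd i j).1.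
  by have [] := svalP (cid (numP i j)).
pose d := \prod_(k : 'I_m * 'I_p) (nd k.1 k.2).2.
pose C := \matrix_(i, j)
  ((nd i j).1 * \prod_(k : 'I_m * 'I_p | k != (i, j)) (nd k.1 k.2).2).
exists d, C; split; first by apply/prodf_neq0 => k _.
apply/matrixP => i j; rewrite !mxE /d (bigD1 (i, j)) //= !tofracM -ndB.
by rewrite mulrC mulrA.
Qed.

Section Jacobian.
Variable K : numFieldType.

Definition jacobian n N (F : 'I_N -> mpoly n K) : 'M[mpoly n K]_(N, n) :=
  \matrix_(j, k) mderiv k (F j).

Lemma map_mx_inj_tofrac (A : idomainType) m p :
  injective (fun M : 'M[A]_(m, p) => map_mx (@tofrac A) M).
Proof.
move=> B C /= /matrixP BC; apply/matrixP => i j.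
by have := BC i j; rewrite !mxE => /eqP; rewrite tofrac_eq => /eqP.
Qed.

(** A right inverse over the field of fractions specialises wherever its common
    denominator does not vanish. *)
Lemma row_free_meval n N (M : 'M[mpoly n K]_(N, n)) :
  row_free (map_mx (@tofrac _) M) -> exists x, row_free (map_mx (meval x) M).
Proof.
case/row_freeP => B MB; have [d [C [d0 dB]]] := clear_denominators B.
have MC : M *m C = d%:M.
  apply: map_mx_inj_tofrac; rewrite map_mxM -dB -scalemxAr MB map_scalar_mx /=.
  by rewrite scalemx1.
have [x dx] := meval_neq0 d0; exists x.
apply/row_freeP; exists ((meval x d)^-1 *: map_mx (meval x) C).
rewrite -scalemxAr -map_mxM MC map_scalar_mx /= -scalemx1 scalerA mulVf //.
by rewrite scale1r.
Qed.

Lemma mx_kernel (A : idomainType) N n (M : 'M[A]_(N, n)) :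
  (N <= n)%N -> ~~ row_free (map_mx (@tofrac A) M) ->
  exists2 b : 'cV[A]_n, b != 0 & M *m b = 0.
Proof.
move=> Nn; set ML := map_mx _ M => MLf.
have rML : (\rank ML < n)%N.
  by apply: leq_trans Nn; rewrite ltn_neqAle rank_leq_row andbT.
have kM : kermx ML^T != 0.
  by rewrite kermx_eq0 /row_free mxrank_tr neq_ltn rML.
case/rowV0Pn: kM => u /sub_kermxP uM u0.
have [d [C [d0 dC]]] := clear_denominators u^T.
exists C.
  apply: contraNneq u0 => C0; move: dC; rewrite C0 map_mx0 => /eqP.
  by rewrite scaler_eq0 tofrac_eq0 (negbTE d0) trmx_eq0.
apply: map_mx_inj_tofrac; rewrite map_mx0 map_mxM -dC -/ML -scalemxAr.
by rewrite -[ML]trmxK -trmx_mul uM trmx0 scaler0.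
Qed.

Lemma row_free_colsub (F : fieldType) m n p (f : 'I_p -> 'I_n) (A : 'M[F]_(m, n)) :
  row_free (colsub f A) -> row_free A.
Proof.
move=> Af; apply: inj_row_free => v vA.
apply/eqP; rewrite -(mulmx_free_eq0 v Af); apply/eqP/matrixP => i j.
have /matrixP/(_ i (f j)) := vA; rewrite !mxE => vAj; rewrite -[RHS]vAj.
by apply: eq_bigr => k _; rewrite !mxE.
Qed.

Lemma jacobian_slice n N (F : 'I_N -> mpoly n.+1 K) k c x :
  map_mx (meval x) (jacobian (fun j => slice k c (F j))) =
  colsub (lift k) (map_mx (meval (slice_point k c x)) (jacobian F)).
Proof. by apply/matrixP => i j; rewrite !mxE mderiv_slice meval_slice. Qed.

(** Induction on the number n of variables; for n < N counting monomials is
    enough.  Otherwise the Jacobian over the field of fractions has rank less than N <= n,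
    hence a kernel vector b: the derivation [V = sum_i b_i d/dx_i] kills every
    F_j.  Choose k and c such that b_k does not vanish on [x_k = c].  The
    restrictions of the F_j to this hyperplane still have a degenerate Jacobian,
    so they satisfy a relation P.  Then G = P(F) vanishes on the hyperplane and
    V G = 0.  As V is transverse to the hyperplane, V lowers the order of
    vanishing along it by exactly one, so G = 0. *)
Theorem algebraic_dependence_of_jacobian n N (F : 'I_N -> mpoly n K) :
  (forall x, ~~ row_free (map_mx (meval x) (jacobian F))) ->
  exists2 P : mpoly N K, P != 0 & mcomp F P = 0.
Proof.
elim: n F => [|n IHn] F Fx.
  apply: algebraic_dependence; rewrite lt0n; apply/negP => /eqP N0.
  by have := Fx (fun=> 0); move: (map_mx _ _); rewrite N0 => A; rewrite /row_free [A]flatmx0 mxrank0.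
have [nN|Nn] := ltnP n.+1 N; first exact: algebraic_dependence.
have [|b b0 Fb] := @mx_kernel _ N n.+1 (jacobian F) Nn.
  by apply/negP => /row_free_meval[x xF]; have := Fx x; rewrite xF.
have [k bk] : exists k, b k 0 != 0.
  by case/matrix0Pn: b0 => k [j]; rewrite (ord1 j) => bk; exists k.
have [y yb] := meval_neq0 bk.
pose c := y k.
have sbk : slice k c (b k 0) != 0.
  apply: contraNneq yb => sb0; rewrite -(meval_eq _ (slice_pointP k y)).
  by rewrite -meval_slice sb0 meval0.
have [|P P0 PF] := IHn (fun j => slice k c (F j)).
  move=> x; rewrite jacobian_slice; apply/negP => /row_free_colsub.
  exact/negP.
exists P => //; set G := mcomp F P.
have sG : slice k c G = 0 by rewrite slice_mcomp.
pose V g := \sum_i b i 0 * mderiv i g.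
have VM g h : V (g * h) = V g * h + g * V h.
  rewrite /V mulr_suml mulr_sumr -big_split; apply: eq_bigr => i _ /=.
  by rewrite mderivM mulrDr mulrA mulrCA [g * _]mulrC -mulrA [_ * g]mulrC.
have VG : V G = 0.
  rewrite /V /G; under eq_bigr => i _ do rewrite mderiv_mcomp mulr_sumr.
  rewrite exchange_big big1 // => j _ /=.
  under eq_bigr => i _ do rewrite mulrCA.
  rewrite -mulr_sumr; have /matrixP/(_ j 0) := Fb; rewrite !mxE => Fbj.
  rewrite (_ : \sum_i _ = 0) ?mulr0 // -[RHS]Fbj; apply: eq_bigr => i _.
  by rewrite mxE mulrC.
apply/eqP; apply: contraT => G0.
have [m [H [sH GH]]] := factor_hyperplane k c G0.
pose l := mX k - mpolyC n.+1 c : mpoly n.+1 K.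
have sl : slice k c l = 0 by exact: slice_hyperplane.
(* [G = H * l ^ m]: as [V G = 0], the factor [m * H * b_k] vanishes on the
   hyperplane, which is absurd in characteristic 0. *)
case: m GH => [|m] GH; first by rewrite -sG GH mulr1 eqxx in sH.
have Vl : V l = b k 0.
  rewrite /V (bigD1 k) //= big1 ?addr0 => [|i ik].
    rewrite /l mderivB mderivC subr0 mderivX mnm1E eqxx scale1r.
    by rewrite -{1}[mnm1 k]add0m addmK mpolyX0 mulr1.
  by rewrite /l mderivB mderivC subr0 mderivX mnm1E eq_sym (negbTE ik) scale0r mulr0.
have VlX a : V (l ^+ a.+1) = a.+1%:R * (l ^+ a * b k 0).
  elim: a => [|a IH]; first by rewrite expr1 Vl expr0 !mul1r.
  rewrite exprS VM IH Vl exprS -[a.+2]add1n natrD.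
  move: (a.+1%:R) (l ^+ a) (b k 0) (l) => e u v z.
  by rewrite mulrDl mul1r [v * _]mulrC -!mulrA; congr (_ + _); rewrite mulrCA.
have l0 : l != 0.
  by apply: contraNneq G0 => l0; rewrite GH -/l l0 expr0n mulr0.
move: VG; rewrite GH VM -/l VlX exprS => VG.
have : V H * l + H * (m.+1%:R * b k 0) = 0.
  apply: (mulIf (expf_neq0 m l0)); rewrite mul0r -[RHS]VG.
  rewrite mulrDl -!mulrA; congr (_ + H * (_ * _)).
  by rewrite mulrC.
move=> /(congr1 (slice k c)); rewrite rmorphD !rmorphM rmorph_nat rmorph0 /= sl mulr0 add0r.
move/eqP; rewrite !mulf_eq0 (negbTE sH) (negbTE sbk) orbF /=.
by rewrite -(rmorph_nat (@mpolyC n K)) mpolyC_eq0 pnatr_eq0.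
Qed.

Variables (L : numFieldType) (phi : {rmorphism K -> L}).

(** Take a relation P of minimal degree.  By the chain rule the vector of the
    (dP/dy_j)(F) is in the left kernel of the Jacobian, which is zero as soon as
    the Jacobian has full rank at one point, even with coordinates in an extension
    of the field.  So the partial derivatives of P are relations of smaller degree,
    hence zero, and P is constant. *)
Theorem algebraic_independence_of_jacobian n N (F : 'I_N -> mpoly n K) x :
  row_free (map_mx (meval x \o map_mpoly phi) (jacobian F)) ->
  forall P : mpoly N K, mcomp F P = 0 -> P = 0.
Proof.
case/row_freeP => B FB P.
have [s] := ubnP (mmeasure mdeg P); elim: s P => // s IHs P Ps PF.
have [//|P0] := eqVneq P 0.
suff dP j : mderiv j P = 0.
  move: PF P0; rewrite (mderiv_eq0_const dP) mmapC => /eqP.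
  by rewrite !mpolyC_eq0 => ->.
suff dPF j' : mcomp F (mderiv j' P) = 0.
  by apply: IHs => //; exact: leq_trans (msize_mderiv _ P0) Ps.
pose w : 'rV[mpoly n K]_N := \row_j mcomp F (mderiv j P).
have wF : w *m jacobian F = 0.
  apply/rowP => k; have := congr1 (mderiv k) PF.
  rewrite mderiv_mcomp raddf0 !mxE => dPF; rewrite -[RHS]dPF.
  by apply: eq_bigr => i _; rewrite !mxE.
(* [B] inverts the Jacobian at [x], so the determinant of [M] is 1 there. *)
pose M := map_mx (map_mpoly phi) (jacobian F) *m map_mx (@mpolyC n L) B.
have M0 : \det M != 0.
  have : meval x (\det M) != 0.
    rewrite -det_map_mx map_mxM -!map_mx_comp.
    rewrite (_ : map_mx (meval x \o @mpolyC n L) B = B); last first.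
      by apply/matrixP => i l; rewrite mxE /= mevalC.
    by rewrite [X in X *m _](_ : _ = map_mx (meval x \o map_mpoly phi) (jacobian F)) // FB det1 oner_eq0.
  by apply: contraNneq => ->; rewrite meval0.
have wM : map_mx (map_mpoly phi) w *m M = 0.
  by rewrite mulmxA -map_mxM wF map_mx0 mul0mx.
have : map_mx (map_mpoly phi) w = 0.
  have : map_mx (map_mpoly phi) w *m (M *m \adj M) = 0 by rewrite mulmxA wM mul0mx.
  rewrite mul_mx_adj mul_mx_scalar => /eqP.
  by rewrite scalemx_eq0 (negbTE M0) => /eqP.
move=> /rowP/(_ j'); rewrite !mxE => wj.
apply/mpolyP => m; apply: (fmorph_inj phi).
by rewrite -mcoeff_map_mpoly wj !mcoeff0 rmorph0.
Qed.

End Jacobian.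

(** * Dimension of the zero set of a nonzero polynomial *)

Section Krull.
Variable K : numFieldType.

(** Prime ideals as plain sets, so that the zero ideal of a domain can be put at
    the bottom of a chain. *)
Definition prime_set (A : comNzRingType) (S : set A) :=
  [/\ ~ S 1, forall a b, S a -> S b -> S (a - b), forall a b, S b -> S (a * b)
    & forall a b, S (a * b) -> S a \/ S b].

(** Elements y_i that lie in I_(i+1) but not in I_i satisfy no algebraic relation
    Q.  Factor the largest power of the first variable out of Q; as y_0 is not in
    I_0, the cofactor is still a relation modulo I_0.  Modulo I_1 it only depends on
    its restriction to [x_0 = 0], a nonzero relation between the remaining y_i. *)
Lemma chain_independence (A : comNzRingType) (phi : {rmorphism K -> A}) N
    (I : nat -> set A) (y : 'I_N -> A) (Q : mpoly N K) :
  (forall i, (i <= N)%N -> prime_set (I i)) ->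
  (forall i, (i < N)%N -> I i `<=` I i.+1) ->
  (forall i : 'I_N, ~ I i (y i)) -> (forall i : 'I_N, I i.+1 (y i)) ->
  Q != 0 -> ~ I 0%N (mmap phi y Q).
Proof.
elim: N I y Q => [|N IHN] I y Q Ip Ile yN yS Q0 IQ.
  have [I1 _ IM _] := Ip _ (leqnn 0); apply: I1.
  move: Q0 IQ; rewrite [Q]nvar0_mpolyC mmapC mpolyC_eq0.
  move: (mcoeff _ _) => c c0 /(IM (phi c^-1)).
  by rewrite -rmorphM mulVf // rmorph1.
have [I1 IB IM Ipr] := Ip 0%N isT.
have [m [H [sH]]] := factor_hyperplane ord0 0 Q0.
rewrite mpolyC0 subr0 => QH; move: IQ; rewrite QH rmorphM rmorphXn /= mmapXU.
have yX : ~ I 0%N (y ord0 ^+ m).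
  elim: (m) => [|a IHa]; rewrite ?expr0 ?exprS //.
  by case/Ipr => // Iy; exact: (yN ord0).
case/Ipr => // IH.
have [q Hq] := sub_mlift_slice ord0 H.
have [_ IB1 IM1 _] := Ip 1%N isT.
have : I 1%N (mmap phi y (mlift ord0 (slice ord0 0 H))).
  rewrite -[mlift _ _](subKr H) Hq rmorphB rmorphM /= mmapXU; apply: IB1.
    exact: Ile IH.
  exact/IM1/(yS ord0).
have -> : mmap phi y (mlift ord0 (slice ord0 0 H)) =
          mmap phi (y \o lift ord0) (slice ord0 0 H).
  apply: (@mpoly_rmorph_ext _ _ _ (mmap phi y \o mlift ord0) (mmap phi (y \o lift ord0))).
    by move=> c; rewrite /= mliftC !mmapC.
  by move=> i; rewrite /= mliftX !mmapXU.
apply: (IHN (I \o succn)) => //= [i iN|i iN|i|i].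
- exact: Ip.
- exact: Ile.
- exact: (yN (lift ord0 i)).
- exact: (yS (lift ord0 i)).
Qed.

End Krull.

Lemma prime_idealr_set (A : comNzRingType) (P : prime_idealr A) :
  prime_set [set a | a \in P].
Proof.
split => [|a b|a b|a b] /=.
- by rewrite idealr1.
- exact: rpredB.
- exact: idealMr.
- by rewrite prime_idealrM => /orP.
Qed.

Lemma idomain_zero_prime (A : idomainType) : prime_set [set (0 : A)].
Proof.
split => [|a b|a b|a b] /=.
- by move/eqP; rewrite oner_eq0.
- by move=> -> ->; rewrite subr0.
- by move=> ->; rewrite mulr0.
- by move/eqP; rewrite mulf_eq0 => /orP[] /eqP; [left|right].
Qed.

(** A chain of d + 1 primes whose smallest one contains h gives, with the zero ideal
    added below it, d + 1 algebraically independent elements; so d < n. *)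
Lemma sa_dim_lt (R : realType) n (Z : set 'rV[R]_n) (h : mpoly n R) :
  h != 0 -> (forall x, Z x -> peval h x = 0) -> (0 < n)%N ->
  (sa_dim Z < (n%:R : R)%:E)%E.
Proof.
move=> h0 Zh n0.
suff dn d : prime_chain Z d -> (d < n)%N.
  apply: (@le_lt_trans _ _ ((n.-1)%:R%:E)).
    apply: ge_ereal_sup => _ [d /dn dn' <-].
    by rewrite lee_fin ler_nat -ltnS prednK.
  by rewrite lte_fin ltr_nat prednK.
case=> P [ZP chain]; rewrite ltnNge; apply/negP => nd.
(* The chain with the zero ideal prepended. *)
pose I i : set (mpoly n R) := if i is i'.+1 then [set a | a \in P (inord i')] else [set 0].
have stepP i : (i < d)%N -> exists a, a \in P (inord i.+1) /\ a \notin P (inord i).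
  move=> id; have lt : ((inord i : 'I_d.+1) < (inord i.+1 : 'I_d.+1))%N.
    by rewrite !inordK // ltnS // ltnW.
  have [_ nsub] := chain _ _ lt; apply: contrapT => H; apply: nsub => a aP.
  by apply: contrapT => /negP aP'; apply: H; exists a.
have yP (i : 'I_d.+1) : exists a, I i.+1 a /\ ~ I i a.
  case: i => -[|i] id /=.
    by exists h; split; [apply: ZP | apply/eqP].
  by have [a [aS aN]] := stepP i id; exists a; split=> //; exact/negP.
pose y i := sval (cid (yP i)).
have [Q Q0 yQ] := @algebraic_dependence R n d.+1 y nd.
apply: (@chain_independence R _ (@mpolyC n R) d.+1 I y Q) => //.
- case=> [|i] _; first exact: idomain_zero_prime.
  exact: prime_idealr_set.
- case=> [_ _ -> /=|i id]; first exact: rpred0.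
  move=> a; apply: (chain (inord i) (inord i.+1) _).1.
  by rewrite !inordK // ltnW.
- by move=> i; have [] := svalP (cid (yP i)).
- by move=> i; have [] := svalP (cid (yP i)).
Qed.

(** * Semialgebraic sets *)

Section Semialgebraic.
Variable R : realType.

(** Semialgebraic sets as Boolean combinations of polynomial inequalities: this form
    is suited to proofs by induction, and [sa_semialgebraic] puts it in normal form. *)
Inductive sa n : set 'rV[R]_n -> Prop :=
| sa_pos p : sa [set x | 0 < peval p x]
| sa_setC A : sa A -> sa (~` A)
| sa_setI A B : sa A -> sa B -> sa (A `&` B).

Lemma sa_setU n (A B : set 'rV[R]_n) : sa A -> sa B -> sa (A `|` B).
Proof.
by move=> sA sB; rewrite -[_ `|` _]setCK setCU; apply/sa_setC/sa_setI; apply: sa_setC.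
Qed.

Lemma sa_setT n : sa [set: 'rV[R]_n].
Proof.
rewrite (_ : setT = [set x | 0 < peval 1 x]); first exact: sa_pos.
by apply/seteqP; split=> x //= _; rewrite /peval rmorph1 ltr01.
Qed.

Lemma sa_ext n (A B : set 'rV[R]_n) : sa A -> (forall x, A x <-> B x) -> sa B.
Proof. by move=> sA AB; rewrite -(_ : A = B) //; apply/predeqP. Qed.

Lemma sa_eq0 n p : sa [set x : 'rV[R]_n | peval p x = 0].
Proof.
apply: (sa_ext (sa_setI (sa_setC (sa_pos p)) (sa_setC (sa_pos (- p))))) => x /=.
rewrite /peval mevalN oppr_gt0; split=> [[/negP p1 /negP p2]|->]; last by rewrite ltxx.
by apply: le_anti; rewrite !leNgt p1 p2.
Qed.

Lemma sa_forall n (T : finType) (A : T -> set 'rV[R]_n) :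
  (forall i, sa (A i)) -> sa [set x | forall i, A i x].
Proof.
move=> sA; suff sAs (s : seq T) : sa [set x | forall i, i \in s -> A i x].
  apply: (sa_ext (sAs (enum T))) => x /=; split=> Ax i; last by move=> _; exact: Ax.
  by apply: Ax; rewrite mem_enum.
elim: s => [|i s IHs]; first by apply: (sa_ext (sa_setT n)) => x; split.
apply: (sa_ext (sa_setI (sA i) IHs)) => x /=; split=> [[Ai As] j|As].
  by rewrite inE => /predU1P[->|/As].
by split=> [|j js]; apply: As; rewrite inE ?eqxx ?js ?orbT.
Qed.

Lemma semialgebraicU n (A B : set 'rV[R]_n) :
  semialgebraic A -> semialgebraic B -> semialgebraic (A `|` B).
Proof.
move=> [s ->] [t ->]; exists (s ++ t); apply/predeqP => x; split.
  case=> -[b /= bs bx]; exists b => //=; rewrite mem_cat bs ?orbT //.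
by case=> b /=; rewrite mem_cat => /orP[] bs bx; [left|right]; exists b.
Qed.

Lemma basic_semialgebraicI n (b c : seq (mpoly n R) * seq (mpoly n R)) :
  basic_semialgebraic b `&` basic_semialgebraic c =
  basic_semialgebraic (b.1 ++ c.1, b.2 ++ c.2).
Proof.
apply/predeqP => x; split=> [[[b1 b2] [c1 c2]]|[bc1 bc2]].
  by split=> p /=; rewrite mem_cat => /orP[]; auto.
by split; split=> p pP; [apply: bc1|apply: bc2|apply: bc1|apply: bc2];
  rewrite mem_cat pP ?orbT.
Qed.

Lemma semialgebraicI n (A B : set 'rV[R]_n) :
  semialgebraic A -> semialgebraic B -> semialgebraic (A `&` B).
Proof.
move=> [s ->] [t ->]; exists [seq (b.1 ++ c.1, b.2 ++ c.2) | b <- s, c <- t].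
apply/predeqP => x; split.
  case=> -[b /= bs bx] [c /= ct cx]; exists (b.1 ++ c.1, b.2 ++ c.2) => /=.
    by apply/allpairsP; exists (b, c).
  by rewrite -basic_semialgebraicI.
case=> _ /= /allpairsP[[b c] /= [bs ct ->]]; rewrite -basic_semialgebraicI => -[bx cx].
by split; [exists b|exists c].
Qed.

Lemma semialgebraic_basic n (b : seq (mpoly n R) * seq (mpoly n R)) :
  semialgebraic (basic_semialgebraic b).
Proof.
exists [:: b]; apply/predeqP => x; split=> [bx|[c /=]]; first by exists b; rewrite //= inE.
by rewrite inE => /eqP ->.
Qed.

Lemma semialgebraic0 n : semialgebraic (set0 : set 'rV[R]_n).
Proof. by exists [::]; apply/predeqP => x; split=> // -[]. Qed.

Lemma semialgebraicT n : semialgebraic (setT : set 'rV[R]_n).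
Proof.
rewrite (_ : setT = basic_semialgebraic ([::], [::])); first exact: semialgebraic_basic.
by apply/predeqP => x; split.
Qed.

Lemma semialgebraic_pos n (p : mpoly n R) : semialgebraic [set x | 0 < peval p x].
Proof.
rewrite (_ : mkset _ = basic_semialgebraic ([::], [:: p])); first exact: semialgebraic_basic.
apply/predeqP => x; split=> [px|[_ /(_ p)]]; last by rewrite inE; apply.
by split=> // q; rewrite inE => /eqP ->.
Qed.

Lemma semialgebraic_eq0 n (p : mpoly n R) : semialgebraic [set x | peval p x = 0].
Proof.
rewrite (_ : mkset _ = basic_semialgebraic ([:: p], [::])); first exact: semialgebraic_basic.
apply/predeqP => x; split=> [px|[/(_ p) + _]]; last by rewrite inE; apply.
by split=> // q; rewrite inE => /eqP ->.
Qed.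

Lemma semialgebraic_Npos n (p : mpoly n R) : semialgebraic [set x | ~ 0 < peval p x].
Proof.
rewrite (_ : mkset _ = [set x | peval p x = 0] `|` [set x | 0 < peval (- p) x]).
  by apply: semialgebraicU; [exact: semialgebraic_eq0 | exact: semialgebraic_pos].
apply/predeqP => x /=; rewrite /peval mevalN oppr_gt0; split.
  by move/negP; rewrite -leNgt le_eqVlt => /predU1P[]; [left|right].
by case=> [->|/ltW]; rewrite ?ltxx // leNgt => /negP.
Qed.

Lemma semialgebraicC n (A : set 'rV[R]_n) : semialgebraic A -> semialgebraic (~` A).
Proof.
case=> s ->; elim: s => [|b s IHs].
  rewrite (_ : ~` _ = setT); first exact: semialgebraicT.
  by apply/predeqP => x; split=> // _ [].
rewrite bigcup_seq big_cons -bigcup_seq setCU; apply: semialgebraicI => //.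
case: b => eqs pos; rewrite (_ : ~` _ =
    \bigcup_(p in [set` eqs]) [set x | peval p x != 0] `|`
    \bigcup_(q in [set` pos]) [set x | ~ 0 < peval q x]); last first.
  apply/predeqP => x; split.
    move=> Nx; apply: contrapT => /not_orP[N1 N2]; apply: Nx; split=> p ps /=.
      by apply/eqP; apply: contrapT => /negP p0; apply: N1; exists p.
    by apply: contrapT => p0; apply: N2; exists p.
  case=> -[p /= ps px] [b1 b2]; first by rewrite b1 ?eqxx in px.
  exact/px/b2.
apply: semialgebraicU.
  elim: eqs => [|p t IHt]; first by rewrite bigcup_seq big_nil; exact: semialgebraic0.
  rewrite bigcup_seq big_cons -bigcup_seq; apply: semialgebraicU => //.
  rewrite (_ : mkset _ = [set x | 0 < peval p x] `|` [set x | 0 < peval (- p) x]).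
    by apply: semialgebraicU; exact: semialgebraic_pos.
  by apply/predeqP => x /=; rewrite /peval mevalN oppr_gt0 neq_lt orbC; split=> /orP.
elim: pos => [|p t IHt]; first by rewrite bigcup_seq big_nil; exact: semialgebraic0.
rewrite bigcup_seq big_cons -bigcup_seq; apply: semialgebraicU => //.
exact: semialgebraic_Npos.
Qed.

Lemma sa_semialgebraic n (A : set 'rV[R]_n) : sa A -> semialgebraic A.
Proof.
elim=> [p|B _|B C _ + _]; first exact: semialgebraic_pos.
  exact: semialgebraicC.
exact: semialgebraicI.
Qed.

(** Polynomial functions and maps described by their values only, which is all that
    is needed to take preimages of semialgebraic sets. *)
Definition polyfun n (f : 'rV[R]_n -> R) := exists p, forall x, f x = peval p x.
Definition polymap n m (F : 'rV[R]_n -> 'rV[R]_m) :=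
  forall i, polyfun (fun x => F x 0 i).

Lemma polyfun_peval n (p : mpoly n R) : polyfun (peval p).
Proof. by exists p. Qed.

Lemma polyfun_cst n c : polyfun (fun _ : 'rV[R]_n => c).
Proof. by exists (mpolyC n c) => x; rewrite /peval mevalC. Qed.

Lemma polyfunD n (f g : 'rV[R]_n -> R) :
  polyfun f -> polyfun g -> polyfun (fun x => f x + g x).
Proof. by move=> [p fp] [q gq]; exists (p + q) => x; rewrite /peval mevalD fp gq. Qed.

Lemma polyfunM n (f g : 'rV[R]_n -> R) :
  polyfun f -> polyfun g -> polyfun (fun x => f x * g x).
Proof. by move=> [p fp] [q gq]; exists (p * q) => x; rewrite /peval mevalM fp gq. Qed.

Lemma polyfunN n (f : 'rV[R]_n -> R) : polyfun f -> polyfun (fun x => - f x).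
Proof. by move=> [p fp]; exists (- p) => x; rewrite /peval mevalN fp. Qed.

Lemma polymap_id n : polymap (@id 'rV[R]_n).
Proof. by move=> i; exists (mX i) => x; rewrite /peval mevalXU. Qed.

Lemma polymap_cst n m (y : 'rV[R]_m) : polymap (fun _ : 'rV[R]_n => y).
Proof. by move=> i; exact: polyfun_cst. Qed.

Lemma polymap_row_mx n m1 m2 (F : 'rV[R]_n -> 'rV[R]_m1) (G : 'rV[R]_n -> 'rV[R]_m2) :
  polymap F -> polymap G -> polymap (fun x => row_mx (F x) (G x)).
Proof.
move=> pF pG i; case: (split_ordP i) => j ->; [have [p fp] := pF j|have [p fp] := pG j];
  by exists p => x; rewrite ?row_mxEl ?row_mxEr fp.
Qed.

Lemma polymap_lsubmx n m1 m2 (F : 'rV[R]_n -> 'rV[R]_(m1 + m2)) :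
  polymap F -> polymap (fun x => lsubmx (F x)).
Proof. by move=> pF i; have [p fp] := pF (lshift m2 i); exists p => x; rewrite mxE. Qed.

Lemma polymap_rsubmx n m1 m2 (F : 'rV[R]_n -> 'rV[R]_(m1 + m2)) :
  polymap F -> polymap (fun x => rsubmx (F x)).
Proof. by move=> pF i; have [p fp] := pF (rshift m1 i); exists p => x; rewrite mxE. Qed.

Lemma polymap_castmx n m1 m2 e (F : 'rV[R]_n -> 'rV[R]_m1) :
  polymap F -> polymap (fun x => castmx e (F x) : 'rV[R]_m2).
Proof.
move=> pF i; have [p fp] := pF (cast_ord (esym e.2) i); exists p => x.
by rewrite castmxE cast_ord_id fp.
Qed.

Lemma polymap_scalar n (f : 'rV[R]_n -> R) :
  polyfun f -> polymap (fun x => (f x)%:M : 'rV[R]_1).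
Proof. by move=> [p fp] i; exists p => x; rewrite mxE (ord1 i) eqxx fp. Qed.

Lemma polyfun_comp n m (f : 'rV[R]_m -> R) (F : 'rV[R]_n -> 'rV[R]_m) :
  polyfun f -> polymap F -> polyfun (fun x => f (F x)).
Proof.
move=> [p fp] pF; pose phi i := sval (cid (pF i)).
exists (mmap (@mpolyC n R) phi p) => x; rewrite fp /peval meval_mcomp.
by apply: meval_eq => i; rewrite /phi; case: cid => q /= ->.
Qed.

Lemma sa_preimage n m (F : 'rV[R]_n -> 'rV[R]_m) (A : set 'rV[R]_m) :
  polymap F -> sa A -> sa (F @^-1` A).
Proof.
move=> pF; elim=> [p|B _|B C _ + _]; last by rewrite preimage_setI; exact: sa_setI.
  have [q pq] := polyfun_comp (polyfun_peval p) pF.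
  by apply: (sa_ext (sa_pos q)) => x /=; rewrite pq.
by rewrite preimage_setC; exact: sa_setC.
Qed.

Lemma sa_lt n (f g : 'rV[R]_n -> R) :
  polyfun f -> polyfun g -> sa [set x | f x < g x].
Proof.
move=> pf /polyfunD/(_ (polyfunN pf)) [q fgq].
by apply: (sa_ext (sa_pos q)) => x /=; rewrite -fgq subr_gt0.
Qed.

Lemma sa_eq n (f g : 'rV[R]_n -> R) :
  polyfun f -> polyfun g -> sa [set x | f x = g x].
Proof.
move=> pf /polyfunD/(_ (polyfunN pf)) [q fgq].
apply: (sa_ext (sa_eq0 q)) => x /=; rewrite -fgq; split=> [/eqP|->]; last by rewrite subrr.
by rewrite subr_eq0 => /eqP.
Qed.

Lemma nbhs_rowP n (x : 'rV[R]_n) (A : set 'rV[R]_n) :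
  nbhs x A <-> exists2 e : R, 0 < e & forall y : 'rV[R]_n, (forall i, `|x 0 i - y 0 i| < e) -> A y.
Proof.
split.
  move/nbhs_ballP => [e /= e0 eA]; exists e => // y xy; apply: eA; split=> // i j.
  by rewrite (ord1 i); exact: xy.
case=> e e0 eA; apply/nbhs_ballP; exists e => //= y [_ xy]; apply: eA => i.
exact: (xy 0 i).
Qed.

Lemma open_rowP n (A : set 'rV[R]_n) :
  open A <-> forall x, A x ->
    exists2 e : R, 0 < e & forall y : 'rV[R]_n, (forall i, `|x 0 i - y 0 i| < e) -> A y.
Proof.
rewrite openE; split=> [oA x /oA/nbhs_rowP //|oA x Ax]; exact/nbhs_rowP/oA.
Qed.

Lemma continuous_peval n (p : mpoly n R) : continuous (peval p).
Proof.
elim/mpoly_ring_ind: p => [c|i|p q IHp IHq|p q IHp IHq] x.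
- rewrite (_ : peval _ = cst c); first exact: cst_continuous.
  by apply/funext => y; rewrite /peval mevalC.
- rewrite (_ : peval _ = fun y : 'rV[R]_n => y 0 i); first exact: coord_continuous.
  by apply/funext => y; rewrite /peval mevalXU.
- rewrite (_ : peval _ = peval p \+ peval q); first exact: (cvgD (IHp x) (IHq x)).
  by apply/funext => y; rewrite /peval mevalD.
- rewrite (_ : peval _ = peval p \* peval q); first exact: (cvgM (IHp x) (IHq x)).
  by apply/funext => y; rewrite /peval mevalM.
Qed.

Lemma near_peval n (p : mpoly n R) x (U : set R) :
  open U -> U (peval p x) -> \forall y \near x, U (peval p y).
Proof.
by move=> oU Ux; apply: (@continuous_peval n p x U); apply: open_nbhs_nbhs.
Qed.

Lemma open_peval_neq0 n (p : mpoly n R) : open [set x | peval p x != 0].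
Proof.
rewrite (_ : mkset _ = peval p @^-1` [set t | t != 0]) //.
apply: open_comp => [x _|]; first exact: continuous_peval.
exact: open_neq.
Qed.

(** The polynomial is restricted to the line from a point x0 of the open set to a
    point v where it does not vanish; a small parameter is then not a root. *)
Lemma dense_peval_neq0 n (p : mpoly n R) : p != 0 -> dense [set x | peval p x != 0].
Proof.
move=> p0 U [x0 Ux0] /open_rowP/(_ _ Ux0)[e e0 eU].
have [v pv] := meval_neq0 p0.
pose g : {poly R} := mmap polyC (fun i => (x0 0 i)%:P + (v i - x0 0 i) *: 'X) p.
have gE t : g.[t] = meval (fun i => x0 0 i + (v i - x0 0 i) * t) p.
  rewrite -[LHS]/(horner_eval t g).
  apply: (@mpoly_rmorph_ext _ _ _ (horner_eval t \o mmap polyC _) (meval _)) => [c|i] /=.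
    by rewrite mmapC /horner_eval hornerC mevalC.
  by rewrite mmapXU /horner_eval hornerD hornerC hornerZ hornerX mevalXU.
have g0 : g != 0.
  apply: contraNneq pv => g0; have := gE 1; rewrite g0 horner0 => /esym H.
  rewrite -(meval_eq _ (_ : (fun i => x0 0 i + (v i - x0 0 i) * 1) =1 v)) ?H // => i.
  by rewrite mulr1 subrKC.
pose M := 1 + \sum_i `|v i - x0 0 i|.
have M0 : 0 < M by rewrite ltr_pwDl // sumr_ge0.
(* Parameters so small that the point stays within [e] of [x0]. *)
have u_inj : injective (fun k : nat => e / M / (k.+1%:R : R)).
  move=> a b /(mulfI _) H; have /invr_inj/eqP := H (lt0r_neq0 (divr_gt0 e0 M0)).
  by rewrite eqr_nat => /eqP [].
have [k gk] := infinite_nonroot u_inj g0.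
move: gk; set t := e / M / _; rewrite gE => pt.
exists (\row_i (x0 0 i + (v i - x0 0 i) * t)); split; last first.
  rewrite /= /peval; apply: contraNneq pt => H; rewrite -[X in _ == X]H.
  by apply/eqP/meval_eq => i; rewrite mxE.
apply: eU => i; rewrite mxE opprD addNKr normrN normrM.
have t0 : 0 < t by rewrite !divr_gt0.
rewrite (gtr0_norm t0); apply: (@lt_le_trans _ _ (M * t)).
  rewrite ltr_pM2r // /M (bigD1 i) //= addrA -[ltLHS]addr0.
  by rewrite ltr_leD ?sumr_ge0 // ltrDr.
rewrite /t mulrA [M * _]mulrC divfK ?gt_eqF // ler_pdivrMr ?ltr0n //.
by rewrite ler_pMr // ler1n.
Qed.

(** Off the zero set of the product of the nonzero polynomials that describe A, each
    of them has a locally constant sign. *)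
Lemma sa_generic n (A : set 'rV[R]_n) : sa A ->
  exists2 g : mpoly n R, g != 0 &
    forall x, peval g x != 0 -> \forall y \near x, A y <-> A x.
Proof.
elim=> [p|B _ [g g0 gB]|B C _ [g g0 gB] _ [h h0 hC]].
- have [->|p0] := eqVneq p 0.
    exists 1; first exact: oner_neq0.
    by move=> x _; apply/nbhs_rowP; exists 1 => // y _; rewrite /= /peval !rmorph0 ltxx.
  exists p => // x; rewrite neq_lt => /orP[px|px] /=.
    have : \forall y \near x, peval p y < 0.
      exact: (@near_peval _ p x [set t | t < 0] (@open_lt _ _) px).
    move=> Hn; apply: filterS Hn => y py; by rewrite !ltNge (ltW px) (ltW py).
  have : \forall y \near x, 0 < peval p y.
    exact: (@near_peval _ p x [set t | 0 < t] (@open_gt _ _) px).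
  by move=> Hn; apply: filterS Hn => y py; rewrite px py.
- by exists g => // x /gB; apply: filterS => y; rewrite /setC /=; tauto.
- exists (g * h); first by rewrite mulf_neq0.
  move=> x; rewrite /peval mevalM mulf_eq0 negb_or => /andP[/gB Hg /hC Hh].
  by apply: filterS2 Hg Hh => y; rewrite /setI /=; tauto.
Qed.

End Semialgebraic.

(** * Projections of semialgebraic sets *)

Section TarskiSeidenberg.
Variable R : realType.

Definition coords n (x : 'rV[R]_n) : seq R := [tuple x 0 i | i < n].

Lemma coordsE n (x : 'rV[R]_n) (i : 'I_n) : (coords x)`_i = x 0 i.
Proof. by rewrite -tnth_nth tnth_mktuple. Qed.

Lemma coords_default n (x : 'rV[R]_n) i : (n <= i)%N -> (coords x)`_i = 0.
Proof. by move=> ni; rewrite nth_default // size_tuple. Qed.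

Lemma coords_rcons n (x : 'rV[R]_n) (t : R) :
  GRing.same_env (coords (row_mx x (t%:M : 'rV_1))) (set_nth 0 (coords x) n t).
Proof.
move=> i; rewrite nth_set_nth /=; have [->|ni] := eqVneq i n.
  have n1 : (n < n + 1)%N by rewrite addn1.
  rewrite (coordsE _ (Ordinal n1)) (_ : Ordinal n1 = rshift n ord0).
    by rewrite row_mxEr mxE eqxx.
  by apply: val_inj; rewrite /= addn0.
have [i_n|n_i] := ltnP i n.
  have n1 : (i < n + 1)%N by rewrite addn1 ltnW.
  rewrite (coordsE _ (Ordinal n1)) (coordsE _ (Ordinal i_n)).
  rewrite (_ : Ordinal n1 = lshift 1 (Ordinal i_n)); first by rewrite row_mxEl.
  exact: val_inj.
by rewrite !coords_default // addn1 ltn_neqAle eq_sym ni.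
Qed.

Lemma mpoly_term n (p : mpoly n R) : exists t : GRing.term R,
  forall x, GRing.eval (coords x) t = peval p x.
Proof.
elim/mpoly_ring_ind: p => [c|i|p q [t Ht] [u Hu]|p q [t Ht] [u Hu]].
- by exists (GRing.Const c) => x; rewrite /peval mevalC.
- by exists (GRing.Var R i) => x; rewrite /peval mevalXU /= coordsE.
- by exists (GRing.Add t u) => x; rewrite /peval mevalD /= Ht Hu.
- by exists (GRing.Mul t u) => x; rewrite /peval mevalM /= Ht Hu.
Qed.

Lemma sa_formula n (A : set 'rV[R]_n) : sa A -> exists f : ordered_qelim.ord.formula R,
  forall x, A x <-> ordered_qelim.ord.holds (coords x) f.
Proof.
elim=> [p|B _ [f Hf]|B C _ [f Hf] _ [g Hg]].
- have [t Ht] := mpoly_term p.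
  by exists (ordered_qelim.ord.Lt (GRing.Const 0) t) => x /=; rewrite Ht.
- by exists (ordered_qelim.ord.Not f) => x /=; rewrite -Hf.
- by exists (ordered_qelim.ord.And f g) => x /=; rewrite -Hf -Hg.
Qed.

Lemma rterm_polyfun n (t : GRing.term R) : GRing.rterm t ->
  polyfun (fun x : 'rV[R]_n => GRing.eval (coords x) t).
Proof.
elim: t => //=.
- move=> i _; have [i_n|n_i] := ltnP i n; last first.
    by exists 0 => x; rewrite coords_default // /peval meval0.
  by exists (mX (Ordinal i_n)) => x; rewrite (coordsE _ (Ordinal i_n)) /peval mevalXU.
- by move=> c _; exact: polyfun_cst.
- by move=> m _; exact: polyfun_cst.
- by move=> t IHt u IHu /andP[/IHt Ht /IHu Hu]; exact: polyfunD.
- by move=> t IHt /IHt Ht; exact: polyfunN.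
- move=> t IHt m /IHt Ht.
  have [p Hp] := polyfunM Ht (@polyfun_cst R n m%:R).
  by exists p => x; rewrite -Hp mulr_natr.
- by move=> t IHt u IHu /andP[/IHt Ht /IHu Hu]; exact: polyfunM.
- move=> t IHt m /IHt Ht; elim: m => [|m IHm]; first exact: polyfun_cst.
  have [p Hp] := polyfunM Ht IHm.
  by exists p => x; rewrite -Hp exprS.
Qed.

Lemma qf_sa n (f : ordered_qelim.ord.formula R) :
  ordered_qelim.ord.qf_form f && ordered_qelim.ord.rformula f ->
  sa [set x : 'rV[R]_n | ordered_qelim.ord.qf_eval (coords x) f].
Proof.
elim: f => //=.
- move=> [] _; first by apply: (sa_ext (@sa_setT R n)).
  by apply: (sa_ext (sa_setC (@sa_setT R n))) => x; split=> //=; apply.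
- move=> t u /andP[/(@rterm_polyfun n) Ht /(@rterm_polyfun n) Hu].
  by apply: (sa_ext (sa_eq Ht Hu)) => x /=; split=> /eqP.
- move=> t u /andP[/(@rterm_polyfun n) Ht /(@rterm_polyfun n) Hu].
  exact: sa_lt.
- move=> t u /andP[/(@rterm_polyfun n) Ht /(@rterm_polyfun n) Hu].
  apply: (sa_ext (sa_setC (sa_lt Hu Ht))) => x /=.
  by rewrite leNgt; split=> /negP.
- move=> f IHf g IHg /andP[/andP[f1 g1] /andP[f2 g2]].
  apply: (sa_ext (sa_setI (IHf _) (IHg _))); rewrite ?f1 ?g1 // => x /=.
  by split=> /andP.
- move=> f IHf g IHg /andP[/andP[f1 g1] /andP[f2 g2]].
  apply: (sa_ext (sa_setU (IHf _) (IHg _))); rewrite ?f1 ?g1 // => x /=.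
  by split=> /orP.
- move=> f IHf g IHg /andP[/andP[f1 g1] /andP[f2 g2]].
  apply: (sa_ext (sa_setU (sa_setC (IHf _)) (IHg _))); rewrite ?f1 ?g1 // => x /=.
  rewrite implybE; split=> [[/negP ->//|->]|/orP[/negP|]]; rewrite ?orbT //; by [left|right].
- move=> f IHf f1; apply: (sa_ext (sa_setC (IHf f1))) => x /=.
  by split=> /negP.
Qed.

(** Tarski-Seidenberg theorem, from quantifier elimination: A is described by a
    formula and the set obtained from the elimination of its existential closure is
    a Boolean combination again. *)
Lemma sa_proj1 n (A : set 'rV[R]_(n + 1)) : sa A ->
  sa [set x : 'rV[R]_n | exists t : R, A (row_mx x t%:M)].
Proof.
move=> /sa_formula[f Af]; pose g := ordered_qelim.ord.Exists n f.
have qg := @ordered_qelim.ord.quantifier_elim_wf _ _ (@qe_rcf.wf_QE_wproj R) _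
  (ordered_qelim.ord.to_rform_rformula g).
apply: (sa_ext (qf_sa n qg)) => x /=.
split=> [|[t At]].
  move/(qe_rcf.rcf_satP (coords x) g) => /= [t ft]; exists t; apply/Af.
  by apply: ordered_qelim.ord.eq_holds ft => i; rewrite coords_rcons.
apply/(qe_rcf.rcf_satP (coords x) g); exists t.
by move/Af: At; apply: ordered_qelim.ord.eq_holds => i; rewrite coords_rcons.
Qed.

Lemma sa_proj n k (A : set 'rV[R]_(n + k)) : sa A ->
  sa [set x : 'rV[R]_n | exists y : 'rV[R]_k, A (row_mx x y)].
Proof.
elim: k A => [|k IHk] A sA.
  have pF : polymap (fun x : 'rV[R]_n => row_mx x (0 : 'rV[R]_0)).
    exact: polymap_row_mx (@polymap_id R n) (polymap_cst _ _).
  apply: (sa_ext (sa_preimage pF sA)) => x; split=> [Ax|[y]]; first by exists 0.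
  by rewrite (thinmx0 y).
pose F (z : 'rV[R]_(n + k + 1)) : 'rV[R]_(n + k.+1) :=
  row_mx (lsubmx (lsubmx z))
    (castmx (erefl, addn1 k) (row_mx (rsubmx (lsubmx z)) (rsubmx z))).
have pF : polymap F.
  have pid := @polymap_id R (n + k + 1).
  apply: polymap_row_mx; first by do 2 apply: polymap_lsubmx.
  apply: polymap_castmx; apply: polymap_row_mx; last exact: polymap_rsubmx.
  by apply: polymap_rsubmx; apply: polymap_lsubmx.
apply: (sa_ext (IHk _ (sa_proj1 (sa_preimage pF sA)))) => x /=; split.
  case=> y [t]; rewrite /F !row_mxKl !row_mxKr => At.
  by exists (castmx (erefl, addn1 k) (row_mx y t%:M)).
case=> y Ay; pose y' := castmx (erefl, esym (addn1 k)) y : 'rV_(k + 1).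
exists (lsubmx y'), (rsubmx y' 0 0); rewrite /F !row_mxKl !row_mxKr -mx11_scalar hsubmxK.
by rewrite castmxKV.
Qed.

Lemma sa_interior n (A : set 'rV[R]_n) : sa A -> sa A^°.
Proof.
move=> sA.
pose B : set 'rV[R]_(n + 1 + n) := [set z |
  (forall i, `|lsubmx (lsubmx z) 0 i - rsubmx z 0 i| < rsubmx (lsubmx z) 0 0) /\
  ~ A (rsubmx z)].
have sB : sa B.
  have pid := @polymap_id R (n + 1 + n).
  have plr := polymap_rsubmx (polymap_lsubmx pid) 0.
  apply: sa_setI; last exact: sa_setC (sa_preimage (polymap_rsubmx pid) sA).
  apply: sa_forall => i.
  have pd := polyfunD (polymap_lsubmx (polymap_lsubmx pid) i) (polyfunN (polymap_rsubmx pid i)).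
  apply: (sa_ext (sa_setI (sa_lt pd plr) (sa_lt (polyfunN plr) pd))) => z /=.
  by rewrite ltr_norml andbC; split=> /andP.
have sC : sa [set w : 'rV[R]_(n + 1) | 0 < rsubmx w 0 0 /\
    ~ exists y, B (row_mx w y)].
  apply: sa_setI; last exact: sa_setC (sa_proj sB).
  exact: sa_lt (polyfun_cst _ _) (polymap_rsubmx (@polymap_id R _) 0).
apply: (sa_ext (sa_proj1 sC)) => x /=; split.
  case=> e []; rewrite row_mxKr mxE eqxx => e0 NB; apply/nbhs_rowP.
  exists e => // y xy; apply: contrapT => NA; apply: NB; exists y.
  by rewrite /B /= !row_mxKl !row_mxKr; split=> // i; rewrite mxE eqxx.
move=> /nbhs_rowP[e e0 eA]; exists e.
rewrite row_mxKr mxE eqxx; split=> // -[y]; rewrite /B /= !row_mxKl !row_mxKr.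
by case=> xy; apply; apply: eA => i; have := xy i; rewrite mxE eqxx.
Qed.

End TarskiSeidenberg.

(** * Fibres of the projection that forgets the first coordinate *)

(* Joins completeness and the norm on matrices, as the Baire theorem wants. *)
HB.instance Definition _ (R : realType) m n :=
  Uniform_isComplete.Build 'M[R]_(m, n) cauchy_cvg.

Section Fibres.
Variables (R : realType) (n : nat).

Definition row_cons (t : R) (x : 'rV[R]_n) : 'rV[R]_n.+1 := row_mx (t%:M : 'rV[R]_1) x.
Definition row_hd (w : 'rV[R]_n.+1) : R := w 0 ord0.
Definition row_tl (w : 'rV[R]_n.+1) : 'rV[R]_n := @rsubmx _ 1 1 n w.

Lemma row_cons0 t x : row_cons t x 0 ord0 = t.
Proof.
rewrite /row_cons (_ : ord0 = lshift n (ord0 : 'I_1)); last exact: val_inj.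
by rewrite (@row_mxEl _ 1 1 n) mxE.
Qed.

Lemma row_consS t x i : row_cons t x 0 (lift ord0 i) = x 0 i.
Proof.
rewrite /row_cons (_ : lift ord0 i = rshift 1 i); last exact: val_inj.
by rewrite (@row_mxEr _ 1 1 n).
Qed.

Lemma row_hd_cons t x : row_hd (row_cons t x) = t. Proof. exact: row_cons0. Qed.

Lemma row_tl_cons t x : row_tl (row_cons t x) = x. Proof. exact: row_mxKr. Qed.

Lemma row_tlE w i : row_tl w 0 i = w 0 (lift ord0 i).
Proof. by rewrite mxE; congr (w 0 _); exact: val_inj. Qed.

Lemma row_consK w : row_cons (row_hd w) (row_tl w) = w.
Proof.
apply/rowP => i; have [j ->|->] := unliftP ord0 i; first by rewrite row_consS row_tlE.
by rewrite row_cons0.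
Qed.

Lemma row_cons_near (S : set 'rV[R]_n.+1) t (x : 'rV[R]_n) : open S -> S (row_cons t x) ->
  exists2 e : R, 0 < e & forall s (y : 'rV[R]_n), `|t - s| < e ->
    (forall i, `|x 0 i - y 0 i| < e) -> S (row_cons s y).
Proof.
move=> /open_rowP oS /oS[e e0 eS]; exists e => // s y ts xy; apply: eS => i.
by have [j ->|->] := unliftP ord0 i; rewrite ?row_consS ?row_cons0.
Qed.

Lemma row_cons_nbhs (S : set 'rV[R]_n.+1) t (x : 'rV[R]_n) (e : R) : 0 < e ->
  (forall s (y : 'rV[R]_n), `|t - s| < e -> (forall i, `|x 0 i - y 0 i| < e) -> S (row_cons s y)) ->
  nbhs (row_cons t x) S.
Proof.
move=> e0 eS; apply/nbhs_rowP; exists e => // w xw; rewrite -[w]row_consK; apply: eS.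
  by have := xw ord0; rewrite row_cons0.
by move=> i; have := xw (lift ord0 i); rewrite row_consS row_tlE.
Qed.

Lemma polymap_row_cons m (f : 'rV[R]_m -> R) (F : 'rV[R]_m -> 'rV[R]_n) :
  polyfun f -> polymap F -> polymap (fun z => row_cons (f z) (F z)).
Proof. by move=> pf pF; apply: (@polymap_row_mx R m 1 n); first exact: polymap_scalar. Qed.

Lemma polymap_row_tl m (F : 'rV[R]_m -> 'rV[R]_n.+1) :
  polymap F -> polymap (fun z => row_tl (F z)).
Proof. exact: (@polymap_rsubmx R m 1 n). Qed.

Lemma sa_proj_row_cons (A : set 'rV[R]_n.+1) : sa A -> sa [set x | exists t, A (row_cons t x)].
Proof.
move=> sA; have pid := @polymap_id R (n + 1).
have pF := polymap_row_cons (polymap_rsubmx pid 0) (polymap_lsubmx pid).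
apply: (sa_ext (sa_proj1 (sa_preimage pF sA))) => x /=.
by split=> -[t At]; exists t; move: At; rewrite row_mxKl row_mxKr mxE eqxx.
Qed.

Lemma peval_mlift p w : peval (mlift ord0 p) w = peval p (row_tl w) :> R.
Proof.
apply: (@mpoly_rmorph_ext _ _ _ (meval (w 0) \o mlift ord0) (meval (row_tl w 0))).
  by move=> c; rewrite /= mliftC !mevalC.
by move=> i; rewrite /= mliftX !mevalXU row_tlE.
Qed.

Lemma peval_slice f t x : peval (slice ord0 t f) x = peval f (row_cons t x) :> R.
Proof.
rewrite /peval meval_slice; apply: meval_eq => i; rewrite /slice_point.
by case: unliftP => [j ->|->]; rewrite ?row_consS ?row_cons0.
Qed.

End Fibres.

(** The part of A where P holds is relatively open and closed. *)
Lemma locally_constant_connected (T : topologicalType) (A P : set T) :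
  connected A -> (forall x, A x -> \forall y \near x, A y -> (P y <-> P x)) ->
  forall x y, A x -> A y -> P x -> P y.
Proof.
move=> cA lP x y Ax Ay Px.
have AP : A `&` P = A; last by move: Ay; rewrite -AP => -[].
apply: cA; first by exists x.
  exists [set z | A z -> P z]^°; first exact: open_interior.
  apply/seteqP; split=> z [Az zP]; split=> //.
    by apply: filterS (lP _ Az) => w lw /lw ->.
  exact: (interior_subset zP).
exists (~` [set z | A z -> ~ P z]^°); first by apply: open_closedC; exact: open_interior.
apply/seteqP; split=> z [Az zP]; split=> //.
  by move=> /interior_subset; apply.
apply: contrapT => NPz; apply: zP.
by apply: filterS (lP _ Az) => w lw /lw [+ _] => /[apply].
Qed.

Section GenericPoints.
Variables (R : realType) (n : nat).

(** Baire category theorem for the complements of countably many hypersurfaces. *)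
Lemma countable_generic (g : nat -> mpoly n R) (U : set 'rV[R]_n) :
  (forall j, g j != 0) -> open U -> U !=set0 ->
  exists x, U x /\ forall j, peval (g j) x != 0.
Proof.
move=> g0 oU U0.
have [|x [Ux gx]] := @Baire R 'rV[R]_n (fun j => [set x | peval (g j) x != 0]) _ U U0 oU.
  by move=> j; split; [exact: open_peval_neq0 | exact: dense_peval_neq0].
by exists x; split=> // j; exact: gx.
Qed.

End GenericPoints.

(** * Bands between consecutive roots *)

Section Bands.
Variables (R : realType) (n : nat) (f : mpoly n.+1 R).

(** In the line through w parallel to the first axis, f has at least i distinct
    roots below w.  The recursion, instead of a count, makes the set visibly
    semialgebraic and monotone in the first coordinate of w, and is meaningful
    even where f vanishes on the whole line. *)
Fixpoint roots_below (i : nat) (w : 'rV[R]_n.+1) : Prop :=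
  if i is j.+1 then
    exists s, [/\ s < row_hd w, peval f (row_cons s (row_tl w)) = 0
                & roots_below j (row_cons s (row_tl w))]
  else True.

(** Between the i-th and the next root. *)
Definition band i : set 'rV[R]_n.+1 :=
  [set w | [/\ peval f w != 0, roots_below i w & ~ roots_below i.+1 w]].

Lemma sa_roots_below i : sa [set w | roots_below i w].
Proof.
elim: i => [|i IHi]; first by apply: (sa_ext (@sa_setT R n.+1)).
have pid := @polymap_id R (n.+1 + 1).
have ps := polymap_rsubmx pid 0.
have pw := polymap_lsubmx pid.
have pF := polymap_row_cons ps (polymap_row_tl pw).
have sB := sa_setI (sa_lt ps (pw ord0)) (sa_setI (sa_preimage pF (sa_eq0 f)) (sa_preimage pF IHi)).
apply: (sa_ext (sa_proj1 sB)) => w /=; split=> -[s].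
  by rewrite row_mxKl row_mxKr mxE eqxx => -[? [? ?]]; exists s.
by case=> ? ? ?; exists s; rewrite row_mxKl row_mxKr mxE eqxx.
Qed.

Lemma sa_band i : sa (band i).
Proof.
apply: (sa_ext (sa_setI (sa_setC (sa_eq0 f))
  (sa_setI (sa_roots_below i) (sa_setC (sa_roots_below i.+1))))) => w.
by split=> [[/eqP ? [? ?]]|[/eqP ? ? ?]].
Qed.

Lemma roots_below_mono i t t' x :
  t <= t' -> roots_below i (row_cons t x) -> roots_below i (row_cons t' x).
Proof.
case: i => // i tt' /= [s]; rewrite !row_hd_cons !row_tl_cons => -[st fs rs].
by exists s; split=> //; exact: lt_le_trans tt'.
Qed.

Lemma roots_below_pred i w : roots_below i.+1 w -> roots_below i w.
Proof.
elim: i w => // i IHi w [s [st fs rs]]; exists s; split=> //; exact: IHi.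
Qed.

Lemma roots_below_le i j w : (i <= j)%N -> roots_below j w -> roots_below i w.
Proof.
move=> /subnKC <-; elim: (j - i)%N => [|k IHk]; first by rewrite addn0.
by rewrite addnS => /roots_below_pred.
Qed.

Lemma band_disjoint i j w : band i w -> band j w -> i = j.
Proof.
wlog ij : i j / (i <= j)%N => [H|[_ _ Ni] [_ rj _]].
  by have [/H|/ltnW/H] := leqP i j => // H' bi bj; rewrite (H' bj bi).
apply/eqP; rewrite eqn_leq ij leqNgt; apply/negP => ltij.
by apply: Ni; exact: roots_below_le rj.
Qed.

Lemma band_cover d w : peval f w != 0 -> ~ roots_below d w ->
  exists2 i, (i < d)%N & band i w.
Proof.
move=> fw; elim: d => [|d IHd] Nd; first by case: Nd.
have [rd|/IHd[i id bi]] := pselect (roots_below d w); first by exists d.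
by exists i => //; exact: ltnW.
Qed.

(** The degree of f in its first variable bounds the number of roots on a line where
    f is not identically zero. *)
Lemma roots_below_bound t x : (exists t0, peval f (row_cons t0 x) != 0) ->
  ~ roots_below (size (to_upoly ord0 f)) (row_cons t x).
Proof.
case=> t0 ft0; pose q := map_poly (meval (x 0)) (to_upoly ord0 f).
have qE s : q.[s] = peval f (row_cons s x).
  by rewrite -peval_slice /peval sliceE -horner_map /= mevalC.
have q0 : q != 0 by apply: contraNneq ft0 => q0; rewrite -qE q0 horner0.
have rootsP i s : roots_below i (row_cons s x) ->
    exists rs : seq R, [/\ size rs = i, uniq rs, all (root q) rs & all (< s) rs].
  elim: i s => [|i IHi] s /=; first by exists [::].
  case=> u; rewrite row_hd_cons row_tl_cons => -[us fu /IHi[rs [<- urs rrs lrs]]].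
  exists (u :: rs); split=> //=.
  - by rewrite urs andbT; apply/negP => /(allP lrs) /=; rewrite ltxx.
  - by rewrite rrs andbT /root qE fu.
  - by rewrite us; apply: sub_all lrs => v vu; exact: lt_trans us.
move=> /rootsP[rs [srs urs rrs _]].
have := max_poly_roots q0 rrs urs; rewrite srs ltnNge.
by rewrite size_poly.
Qed.

(** Take rational heights q1 < t < q2 such that f has no root between them above x.
    Then (q1, x) has at least i roots below it and (q2, x) has not i + 1; by
    hypothesis this persists for the points y near x, and it forces every (s, y) with
    q1 < s < q2 into the band. *)
Lemma band_interior_at i t (x : 'rV[R]_n) :
  (forall q : rat, \forall y \near x,
     roots_below i (row_cons (ratr q) y) <-> roots_below i (row_cons (ratr q) x)) ->
  (forall q : rat, \forall y \near x,
     roots_below i.+1 (row_cons (ratr q) y) <-> roots_below i.+1 (row_cons (ratr q) x)) ->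
  band i (row_cons t x) -> (band i)^° (row_cons t x).
Proof.
move=> near0 near1 [ft rt Nrt].
have [e e0 eP] := row_cons_near (@open_peval_neq0 R _ f) ft.
have noroot s : peval f (row_cons s x) = 0 -> e <= `|t - s|.
  move=> fs; rewrite leNgt; apply/negP => ts.
  have := eP s x ts; rewrite /= fs eqxx => H.
  by have : false by apply: H => k; rewrite subrr normr0.
have [q1 /andP[q1e q1t]] : exists q : rat, (t - e < ratr q) && (ratr q < t).
  have te : t - e < t by rewrite ltrBlDr ltrDl.
  by have [q] := rat_in_itvoo te; rewrite in_itv /=; exists q.
have [q2 /andP[q2t q2e]] : exists q : rat, (t < ratr q) && (ratr q < t + e).
  have te : t < t + e by rewrite ltrDl.
  by have [q] := rat_in_itvoo te; rewrite in_itv /=; exists q.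
have rq1 : roots_below i (row_cons (ratr q1) x).
  case: (i) rt => // j /= [s]; rewrite !row_hd_cons !row_tl_cons => -[st fs rs].
  exists s; split=> //; apply: le_lt_trans q1e.
  have := noroot _ fs; rewrite gtr0_norm ?subr_gt0 //; lra.
have Nrq2 : ~ roots_below i.+1 (row_cons (ratr q2) x).
  move=> /= [s]; rewrite !row_hd_cons !row_tl_cons => -[sq fs rs].
  apply: Nrt; exists s; rewrite row_hd_cons row_tl_cons; split=> //.
  rewrite ltNge; apply/negP => ts; have := noroot _ fs.
  rewrite ler0_norm ?subr_le0 //; lra.
have [e1 e10 E1] := (nbhs_rowP _ _).1 (near0 q1).
have [e2 e20 E2] := (nbhs_rowP _ _).1 (near1 q2).
pose d := Num.min (Num.min e1 e2) (Num.min (t - ratr q1) (ratr q2 - t)).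
have d0 : 0 < d by rewrite !lt_min e10 e20 !subr_gt0 q1t q2t.
apply: (row_cons_nbhs d0) => s y; rewrite /d !lt_min => /andP[_ /andP[ts1 ts2]] xy.
have q1s : ratr q1 < s by move: ts1; rewrite ltr_norml => /andP[_]; lra.
have sq2 : s < ratr q2 by move: ts2; rewrite ltr_norml => /andP[+ _]; lra.
have ri : roots_below i (row_cons s y).
  apply: roots_below_mono (ltW q1s) _; apply: (E1 y _).2 rq1 => k.
  by have := xy k; rewrite !lt_min => /andP[/andP[]].
have Nri : ~ roots_below i.+1 (row_cons (ratr q2) y).
  move=> r2; apply: Nrq2; apply: (E2 y _).1 r2 => k.
  by have := xy k; rewrite !lt_min => /andP[/andP[]].
split=> //; last by move=> rs; apply: Nri; exact: roots_below_mono (ltW sq2) rs.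
by apply/eqP => fs; apply: Nri; exists s; rewrite row_hd_cons row_tl_cons.
Qed.

Lemma sa_roots_below_at i q : sa [set x | roots_below i (row_cons q x)].
Proof.
have pF := polymap_row_cons (polyfun_cst n q) (@polymap_id R n).
exact: sa_preimage pF (sa_roots_below i).
Qed.

(** The set D of base points above which the band is not open is semialgebraic; if the
    conclusion failed, D would contain a ball by genericity.  But a ball contains,
    by Baire, points that are generic for the countably many conditions of
    [band_interior_at]. *)
Lemma band_interior_generic i : exists2 g : mpoly n R, g != 0 &
  forall x, peval g x != 0 -> forall t, band i (row_cons t x) -> (band i)^° (row_cons t x).
Proof.
pose D := [set x | exists t, band i (row_cons t x) /\ ~ (band i)^° (row_cons t x)].
have sD : sa D.
  exact: sa_proj_row_cons (sa_setI (sa_band i) (sa_setC (sa_interior (sa_band i)))).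
have [g g0 gD] := sa_generic sD; exists g => // x gx t bt; apply: contrapT => Nt.
have Dx : D x by exists t.
have /nbhs_rowP[e e0 eD] := gD _ gx.
have qg k (q : rat) : exists p : mpoly n R, p != 0 /\ forall y, peval p y != 0 ->
    \forall z \near y, roots_below k (row_cons (ratr q) z) <-> roots_below k (row_cons (ratr q) y).
  by have [p p0 pP] := sa_generic (sa_roots_below_at k (ratr q)); exists p.
(* Enumerates the polynomials attached to the rational heights for [i] and
   for [i.+1]. *)
pose G j : mpoly n R :=
  if @unpickle (bool * rat)%type j is Some (b, q) then
    sval (cid (qg (if b then i.+1 else i) q)) else 1.
have G0 j : G j != 0.
  rewrite /G; case: unpickle => [[b q]|]; last exact: oner_neq0.
  by case: cid => p [].
have [||y [xy Gy]] := @countable_generic R n G (ball x e) G0.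
- exact: ball_open.
- by exists x; exact: ballxx.
have [_ {}xy] := xy.
have [s [bs]] : D y by apply/eD => // k; exact: xy.
apply; apply: band_interior_at bs => q.
  have := Gy (pickle (false, q)); rewrite /G pickleK.
  by case: cid => p [p0 pP] /= /pP.
have := Gy (pickle (true, q)); rewrite /G pickleK.
by case: cid => p [p0 pP] /= /pP.
Qed.

Lemma band_convex i x t1 t2 s : band i (row_cons t1 x) -> band i (row_cons t2 x) ->
  t1 <= s <= t2 -> band i (row_cons s x).
Proof.
move=> [f1 r1 N1] [f2 r2 N2] /andP[t1s st2].
have rs : roots_below i (row_cons s x) by exact: roots_below_mono r1.
split=> //; last by move=> r; apply: N2; exact: roots_below_mono r.
apply/eqP => fs; apply: N2; move: st2; rewrite le_eqVlt => /predU1P[st|st].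
  by rewrite -st fs eqxx in f2.
by exists s; rewrite row_hd_cons row_tl_cons.
Qed.

End Bands.

(** * Decomposition into open connected cells *)

Section Cells.
Variable R : realType.

(** The fibres of W over C are intervals, and are nonempty over all points of C or over
    none.  If V1 and V2 are disjoint open sets covering W, each fibre is inside one of
    them; since V1 and V2 are open, which one it is does not change locally on C, hence
    not at all. *)
Lemma connected_band n (f : mpoly n.+1 R) (C : set 'rV[R]_n) i :
  connected C -> open [set w | C (row_tl w) /\ band f i w] ->
  (forall x y, C x -> C y -> (exists t, band f i (row_cons t x)) -> exists t, band f i (row_cons t y)) ->
  connected [set w | C (row_tl w) /\ band f i w].
Proof.
set W := mkset _ => cC oW ne B0 [w0 Bw0] [U oU BU] [F cF BF].
pose V1 := W `&` U; pose V2 := W `&` ~` F.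
have oV1 : open V1 by exact: openI.
have oV2 : open V2 by apply: openI => //; exact: closed_openC.
have V12 w : W w -> ~ V1 w -> V2 w.
  move=> Ww NV1; split=> // Fw; apply: NV1.
  by rewrite -/V1 -[V1](BU) BF.
have V1N w : V1 w -> ~ V2 w by rewrite /V1 -BU BF => -[_ Fw] [_].
have fibre x t1 t2 : W (row_cons t1 x) -> W (row_cons t2 x) -> V1 (row_cons t1 x) -> V1 (row_cons t2 x).
  move=> W1 W2; have Cx : C x by case: W1; rewrite row_tl_cons.
  apply: (@locally_constant_connected _ [set t | W (row_cons t x)] [set t | V1 (row_cons t x)]) => //.
    apply/connected_intervalP => s1 s2 [_ b1] [_ b2] s /andP[s1s ss2].
    split; first by rewrite row_tl_cons.
    by apply: (band_convex b1 b2); rewrite s1s ss2.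
  move=> t Wt; have [V1t|NV1t] := pselect (V1 (row_cons t x)).
    have [e e0 eV] := row_cons_near oV1 V1t.
    exists e => // s ts _ /=; split=> // _; apply: eV => // k.
    by rewrite subrr normr0.
  have [e e0 eV] := row_cons_near oV2 (V12 _ Wt NV1t).
  exists e => // s ts _ /=; split=> // /V1N []; apply: eV => // k.
  by rewrite subrr normr0.
have Ww0 : W w0 by move: Bw0; rewrite BU => -[].
suff all1 x : C x -> exists t, V1 (row_cons t x).
  apply/seteqP; split=> w; first by rewrite BU => -[].
  move=> Ww; rewrite BU -/V1; have [Cw _] := Ww; have [t V1t] := all1 _ Cw.
  rewrite -[w]row_consK; apply: (fibre _ t) => //; last by rewrite row_consK.
  by case: V1t.
move=> Cx; have [Cw0 _] := Ww0.
apply: (@locally_constant_connected _ C [set x | exists t, V1 (row_cons t x)] cC _ (row_tl w0)) => //.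
  move=> y Cy /=; have [[t V1t]|NV] := pselect (exists t, V1 (row_cons t y)).
    have [e e0 eV] := row_cons_near oV1 V1t; apply/nbhs_rowP; exists e => // z yz _.
    split=> _; exists t => //; apply: eV => //; by rewrite subrr normr0.
  have [t bt] : exists t, band f i (row_cons t y).
    by apply: (ne (row_tl w0)) => //; exists (row_hd w0); rewrite row_consK; case: Ww0.
  have Wt : W (row_cons t y) by split; rewrite ?row_tl_cons.
  have V2t : V2 (row_cons t y) by apply: V12 => // V1t; apply: NV; exists t.
  have [e e0 eV] := row_cons_near oV2 V2t; apply/nbhs_rowP; exists e => // z yz Cz.
  split=> // -[s V1s]; exfalso; have V2z : V2 (row_cons t z).
    by apply: eV => //; rewrite subrr normr0.
  apply: V1N (V2z); apply: (fibre _ s) => //; first by case: V1s.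
  by split; rewrite ?row_tl_cons //; case: (V2z) => -[].
by exists (row_hd w0); rewrite row_consK /V1 -BU.
Qed.

(** Induction on the number of variables.  The base is decomposed for a polynomial G
    such that, where G does not vanish, f is not zero on the vertical line, its bands
    are open, and whether a band has points on the line is locally constant.  The
    cells are the bands of f above the cells of the base. *)
Theorem cell_decomposition n (f : mpoly n R) : f != 0 ->
  exists (T : finType) (O : T -> set 'rV[R]_n) (h : mpoly n R),
  [/\ h != 0, forall i, [/\ open (O i), connected (O i) & sa (O i)],
      forall i j x, O i x -> O j x -> i = j,
      forall i x, O i x -> peval f x != 0
    & forall x, peval h x != 0 -> exists i, O i x].
Proof.
elim: n f => [|n IHn] f f0.
  have T1 : [set: 'rV[R]_0] = [set 0] by apply/seteqP; split=> x //= _; rewrite thinmx0.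
  exists unit, (fun=> setT), 1; split; first exact: oner_neq0.
  - move=> _; split; [exact: openT| |exact: sa_setT].
    by rewrite T1; exact: connected1.
  - by move=> [] [].
  - move=> _ x _; move: f0; rewrite [f]nvar0_mpolyC /peval mevalC.
    by rewrite mpolyC_eq0.
  - by move=> x _; exists tt.
(* No vertical line on which f is nonzero meets a band of index at least [d]. *)
pose d := size (to_upoly ord0 f).
have [x0 fx0] := meval_neq0 f0.
pose w0 : 'rV[R]_n.+1 := \row_i x0 i.
have fw0 : peval f w0 != 0.
  by rewrite /peval (meval_eq _ (_ : w0 0 =1 x0)) // => i; rewrite mxE.
(* Where [c] does not vanish, f is not zero on the vertical line. *)
pose c := slice ord0 (row_hd w0) f.
have c0 : c != 0.
  apply: contraNneq fw0 => c0; rewrite -[w0]row_consK -peval_slice -/c c0.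
  by rewrite /peval meval0.
have bandP i : exists p : mpoly n R, p != 0 /\ forall x, peval p x != 0 ->
    (forall t, band f i (row_cons t x) -> (band f i)^° (row_cons t x)) /\
    \forall y \near x, (exists t, band f i (row_cons t y)) <-> exists t, band f i (row_cons t x).
  have [p p0 pP] := band_interior_generic f i.
  have [q q0 qP] := sa_generic (sa_proj_row_cons (sa_band f i)).
  exists (p * q); split; first exact: mulf_neq0.
  move=> x; rewrite /peval mevalM mulf_eq0 negb_or => /andP[px qx].
  by split; [exact: pP|exact: qP].
pose g i := sval (cid (bandP i)).
have gP i := svalP (cid (bandP i)).
pose G := c * \prod_(i < d) g i.
have G0 : G != 0.
  by rewrite mulf_neq0 //; apply/prodf_neq0 => i _; have [] := gP i.
have [T [C [h [h0 Cp Cdisj CG Ch]]]] := IHn _ G0.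
have Cc j x : C j x -> peval c x != 0.
  by move/CG; rewrite /peval mevalM mulf_eq0 negb_or => /andP[].
have Cg j x (i : 'I_d) : C j x -> peval (g i) x != 0.
  move/CG; rewrite /peval mevalM (bigD1 i) //= mevalM !mulf_eq0 !negb_or.
  by case/andP => _ /andP[].
pose O (ji : T * 'I_d) := [set w | C ji.1 (row_tl w) /\ band f ji.2 w].
exists (T * 'I_d)%type, O, (mlift ord0 h * f); split.
- rewrite mulf_neq0 //; apply: contraNneq h0 => mh0.
  by rewrite -(mliftK ord0 0 h) mh0 rmorph0.
- case=> j i; have [oC cC sC] := Cp j.
  have oO : open (O (j, i)).
    apply/open_rowP => w [/= Cw bw]; apply/nbhs_rowP.
    have [_ /(_ _ (Cg _ _ i Cw))[bi _]] := gP i.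
    rewrite -[w]row_consK in bw *; have Hb := bi _ bw.
    have HC : nbhs (row_cons (row_hd w) (row_tl w)) [set w | C j (row_tl w)].
      have [e e0 eC] := (open_rowP _).1 oC _ Cw.
      by apply: (row_cons_nbhs e0) => s y _ xy /=; rewrite row_tl_cons; exact: eC.
    by apply: filterS2 HC Hb.
  split=> //.
    apply: connected_band => // x y Cx Cy.
    apply: (@locally_constant_connected _ (C j) [set x | exists t, band f i (row_cons t x)]) => // z Cz.
    have [_ /(_ _ (Cg _ _ i Cz))[_ Hn]] := gP i.
    by apply: filterS Hn.
  apply: sa_setI; last exact: sa_band.
  exact: sa_preimage (polymap_row_tl (@polymap_id R _)) sC.
- move=> [j i] [j' i'] w [/= Cj bi] [/= Cj' bi'].
  by rewrite (Cdisj _ _ _ Cj Cj') (val_inj (band_disjoint bi bi')).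
- by move=> ji w [_ []].
- move=> w; rewrite /peval mevalM mulf_eq0 negb_or => /andP[].
  rewrite -/(peval _ w) peval_mlift => /Ch[j Cj] fw.
  have [|i id bi] := @band_cover _ _ _ d w fw.
    rewrite -[w]row_consK; apply: roots_below_bound; exists (row_hd w0).
    by rewrite -peval_slice; exact: Cc Cj.
  by exists (j, Ordinal id).
Qed.

End Cells.

(** * The polynomial map that parametrises the tensors of bounded rank *)

Lemma mxvec_index_inj m n (i i' : 'I_m) (j j' : 'I_n) :
  (mxvec_index i j == mxvec_index i' j') = (i == i') && (j == j').
Proof.
rewrite -xpair_eqE; apply/eqP/eqP => [|[-> ->]] //.
by move=> /cast_ord_inj /enum_rank_inj.
Qed.

Section Parametrization.
Variables (m1 m2 m3 k : nat).
Local Notation N := (m1 * m2 * m3)%N.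
Local Notation n := (k * (m1 + m2 + m3))%N.

Definition unpack (A : Type) (w : 'rV[A]_n) (l : 'I_k) :
    'rV[A]_m1 * 'rV[A]_m2 * 'rV[A]_m3 :=
  let r := row l (vec_mx w) in (lsubmx (lsubmx r), rsubmx (lsubmx r), rsubmx r).

Lemma unpack_surj A (x : 'I_k -> 'rV[A]_m1 * 'rV[A]_m2 * 'rV[A]_m3) :
  exists w, unpack w = x.
Proof.
exists (mxvec (\matrix_(l, a) row_mx (row_mx (x l).1.1 (x l).1.2) (x l).2 0 a)).
apply/funext => l; rewrite /unpack mxvecK.
set r := row l _; have -> : r = row_mx (row_mx (x l).1.1 (x l).1.2) (x l).2.
  by apply/rowP => a; rewrite !mxE.
by rewrite !row_mxKl !row_mxKr; case: (x l) => -[].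
Qed.

Definition xvar (l : 'I_k) (i : 'I_m1) : 'I_n := mxvec_index l (lshift m3 (lshift m2 i)).
Definition yvar (l : 'I_k) (i : 'I_m2) : 'I_n := mxvec_index l (lshift m3 (rshift m1 i)).
Definition zvar (l : 'I_k) (i : 'I_m3) : 'I_n := mxvec_index l (rshift (m1 + m2) i).

Lemma unpackE A (w : 'rV[A]_n) l :
  [/\ forall i, (unpack w l).1.1 0 i = w 0 (xvar l i),
      forall i, (unpack w l).1.2 0 i = w 0 (yvar l i)
    & forall i, (unpack w l).2 0 i = w 0 (zvar l i)].
Proof. by split=> i; rewrite !mxE. Qed.

Variant var_spec : 'I_n -> Prop :=
| XVar l i : var_spec (xvar l i)
| YVar l i : var_spec (yvar l i)
| ZVar l i : var_spec (zvar l i).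

Lemma varP u : var_spec u.
Proof.
case/mxvec_indexP: u => l a.
case: (split_ordP a) => [b ->|i ->]; last exact: ZVar.
by case: (split_ordP b) => i ->; [exact: XVar | exact: YVar].
Qed.

Lemma xvar_eq l l' i i' : (xvar l i == xvar l' i') = (l == l') && (i == i').
Proof. by rewrite mxvec_index_inj !(inj_eq (@lshift_inj _ _)). Qed.

Lemma yvar_eq l l' i i' : (yvar l i == yvar l' i') = (l == l') && (i == i').
Proof. by rewrite mxvec_index_inj (inj_eq (@lshift_inj _ _)) (inj_eq (@rshift_inj _ _)). Qed.

Lemma zvar_eq l l' i i' : (zvar l i == zvar l' i') = (l == l') && (i == i').
Proof. by rewrite mxvec_index_inj (inj_eq (@rshift_inj _ _)). Qed.

Lemma xvar_yvar l l' i i' : (xvar l i == yvar l' i') = false.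
Proof. by rewrite mxvec_index_inj (inj_eq (@lshift_inj _ _)) eq_lrshift andbF. Qed.

Lemma xvar_zvar l l' i i' : (xvar l i == zvar l' i') = false.
Proof. by rewrite mxvec_index_inj eq_lrshift andbF. Qed.

Lemma yvar_zvar l l' i i' : (yvar l i == zvar l' i') = false.
Proof. by rewrite mxvec_index_inj eq_lrshift andbF. Qed.

Definition var_eqE := (xvar_eq, yvar_eq, zvar_eq, xvar_yvar, xvar_zvar, yvar_zvar,
  fun l l' i i' => etrans (eq_sym (yvar l i) (xvar l' i')) (xvar_yvar l' l i' i),
  fun l l' i i' => etrans (eq_sym (zvar l i) (xvar l' i')) (xvar_zvar l' l i' i),
  fun l l' i i' => etrans (eq_sym (zvar l i) (yvar l' i')) (yvar_zvar l' l i' i)).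

Lemma tensor_index (q : 'I_N) : exists p : 'I_m1 * 'I_m2 * 'I_m3,
  q = mxvec_index (mxvec_index p.1.1 p.1.2) p.2.
Proof.
by case/mxvec_indexP: q => s c; case/mxvec_indexP: s => i j; exists (i, j, c).
Qed.

Definition triple q := sval (cid (tensor_index q)).

Lemma tripleP q : q = mxvec_index (mxvec_index (triple q).1.1 (triple q).1.2) (triple q).2.
Proof. exact: svalP (cid (tensor_index q)). Qed.

Lemma outer_triple (F : fieldType) x y z q :
  (outer x y z : tensor F m1 m2 m3) 0 q =
  x 0 (triple q).1.1 * y 0 (triple q).1.2 * z 0 (triple q).2.
Proof. by rewrite -outerE /tentry -tripleP. Qed.

Section Poly.
Variable K : numFieldType.

(** The q-th coordinate of the sum of k generic rank one tensors. *)
Definition rank_poly (q : 'I_N) : mpoly n K :=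
  \sum_l mX (xvar l (triple q).1.1) * mX (yvar l (triple q).1.2) * mX (zvar l (triple q).2).

Lemma meval_rank_poly (w : 'rV[K]_n) q :
  meval (w 0) (rank_poly q) = rank_one_sum (unpack w) 0 q.
Proof.
rewrite /rank_poly /rank_one_sum summxE raddf_sum; apply: eq_bigr => l _.
have [x y z] := unpackE w l.
by rewrite outer_triple x y z /= !mevalM !mevalXU.
Qed.

Lemma mderivXU (u v : 'I_n) : mderiv v (mX u) = (u == v)%:R :> mpoly n K.
Proof.
rewrite mderivX mnm1E; have [->|] := eqVneq u v; last by rewrite scale0r.
by rewrite scale1r -{1}[mnm1 v]add0m addmK mpolyX0.
Qed.

Variables (L : numFieldType) (phi : {rmorphism K -> L}).

Lemma jacobian_rank_poly (w : 'rV[L]_n) :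
  let J := map_mx (meval (w 0) \o map_mpoly phi) (jacobian rank_poly) in
  [/\ forall l i, (col (xvar l i) J)^T = outer (delta_mx 0 i) (unpack w l).1.2 (unpack w l).2,
      forall l i, (col (yvar l i) J)^T = outer (unpack w l).1.1 (delta_mx 0 i) (unpack w l).2
    & forall l i, (col (zvar l i) J)^T = outer (unpack w l).1.1 (unpack w l).1.2 (delta_mx 0 i)].
Proof.
move=> J.
have JE q u : J q u = \sum_l
    ((xvar l (triple q).1.1 == u)%:R * (unpack w l).1.2 0 (triple q).1.2 * (unpack w l).2 0 (triple q).2
   + (unpack w l).1.1 0 (triple q).1.1 * (yvar l (triple q).1.2 == u)%:R * (unpack w l).2 0 (triple q).2
   + (unpack w l).1.1 0 (triple q).1.1 * (unpack w l).1.2 0 (triple q).1.2 * (zvar l (triple q).2 == u)%:R).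
  rewrite !mxE /= /rank_poly (raddf_sum (mderiv u)) (raddf_sum (map_mpoly phi)).
  rewrite (raddf_sum (meval (w 0))); apply: eq_bigr => l _ /=.
  have [x y z] := unpackE w l; rewrite !mderivM !mderivXU x y z.
  rewrite !(rmorphD, rmorphM, rmorph_nat) /= !map_mpolyX !mevalXU.
  by rewrite mulrDl.
have dE m (i j : 'I_m) : (delta_mx 0 i : 'rV[L]_m) 0 j = (j == i)%:R by rewrite mxE eqxx.
split=> l i; apply/rowP => q; rewrite mxE [LHS]mxE JE outer_triple (bigD1 l) //= big1.
- by rewrite addr0 !var_eqE eqxx /= !mulr0 mul0r !addr0 dE.
- by move=> l' /negbTE ll'; rewrite !var_eqE ll' /= !mul0r !mulr0 mul0r !addr0.
- by rewrite addr0 !var_eqE eqxx /= !mulr0 !mul0r addr0 add0r dE.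
- by move=> l' /negbTE ll'; rewrite !var_eqE ll' /= !mulr0 !mul0r !addr0.
- by rewrite addr0 !var_eqE eqxx /= !mulr0 !mul0r !add0r dE.
- by move=> l' /negbTE ll'; rewrite !var_eqE ll' /= !mulr0 !mul0r !addr0.
Qed.

(** The columns of the Jacobian of the parametrisation are the tangent tensors. *)
Lemma row_free_tangent (w : 'rV[L]_n) :
  row_free (map_mx (meval (w 0) \o map_mpoly phi) (jacobian rank_poly)) <->
  <<tangent_family (unpack w)>>%VS = fullv.
Proof.
have := jacobian_rank_poly w; set J := map_mx _ _ => /= -[Jx Jy Jz]; split.
  case/row_freeP => B JB; apply/eqP; rewrite eqEsubv subvf /=; apply/subvP => T _.
  have -> : T = \sum_u (B *m T^T) u 0 *: (col u J)^T.
    apply: trmx_inj; rewrite -[LHS]mul1mx -JB -mulmxA raddf_sum.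
    apply/matrixP => q z; rewrite (ord1 z) mxE summxE; apply: eq_bigr => u _.
    by rewrite !mxE mulrC.
  apply: memv_suml => u _; apply: memvZ; apply: memv_span; rewrite !mem_cat.
  case: (varP u) => l i; rewrite ?Jx ?Jy ?Jz; apply/orP.
  - by left; apply/allpairsP; exists (l, i); rewrite !mem_enum.
  - by right; apply/orP; left; apply/allpairsP; exists (l, i); rewrite !mem_enum.
  - by right; apply/orP; right; apply/allpairsP; exists (l, i); rewrite !mem_enum.
move=> full; apply: inj_row_free => v vJ.
pose h := linfun (mulmxr v^T : 'rV[L]_N -> 'rV[L]_1).
have vcol u : (col u J)^T *m v^T = 0.
  by rewrite -trmx_mul colE mulmxA vJ mul0mx trmx0.
have sub : (<<tangent_family (unpack w)>> <= lker h)%VS.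
  apply/span_subvP => T; rewrite !mem_cat memv_ker lfunE /=.
  case/or3P => /allpairsP[[l i] [_ _ ->]] /=; rewrite -?Jx -?Jy -?Jz vcol //.
apply/rowP => q; have : (delta_mx 0 q : 'rV[L]_N) \in lker h.
  by apply: (subvP sub); rewrite full memvf.
rewrite memv_ker lfunE /= => /eqP /matrixP/(_ 0 0).
by rewrite -rowE !mxE.
Qed.

End Poly.
End Parametrization.

(** * Real tensors of bounded rank *)

Section RankSets.
Variables (F : fieldType) (m1 m2 m3 : nat).
Local Notation N := (m1 * m2 * m3)%N.
Local Notation rank_set k := (range (@rank_one_sum F m1 m2 m3 k)).

Lemma rank_set_add k (T : tensor F m1 m2 m3) x y z :
  rank_set k T -> rank_set k.+1 (T + outer x y z).
Proof.
case=> u _ <-; exists (fun i => if unlift ord_max i is Some j then u j else (x, y, z)) => //.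
rewrite /rank_one_sum big_ord_recr /= unlift_none /=; congr (_ + _).
apply: eq_bigr => l _; rewrite (_ : widen_ord _ _ = lift ord_max l) ?liftK //.
by apply: val_inj; rewrite /= /bump leqNgt ltn_ord.
Qed.

Lemma outer0 y z : outer 0 y z = 0 :> tensor F m1 m2 m3.
Proof. by rewrite /outer trmx0 mul0mx linear0 trmx0 mul0mx linear0. Qed.

Lemma rank_set_le j k : (j <= k)%N -> rank_set j `<=` rank_set k.
Proof.
move=> /subnKC <-; elim: (k - j)%N => [|d IHd] T; first by rewrite addn0.
by move=> /IHd /(@rank_set_add _ _ 0 0 0); rewrite outer0 addr0 addnS.
Qed.

Lemma rank_set_full T : rank_set N T.
Proof.
have dE m (i j : 'I_m) : (delta_mx 0 i : 'rV[F]_m) 0 j = (j == i)%:R by rewrite mxE eqxx.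
exists (fun q => (T 0 q *: delta_mx 0 (triple q).1.1, delta_mx 0 (triple q).1.2,
  delta_mx 0 (triple q).2)) => //.
apply/rowP => q; rewrite summxE (bigD1 q) //= outer_triple mxE !dE !eqxx !mulr1.
rewrite big1 ?addr0 // => q' qq'; rewrite outer_triple mxE !dE.
have [e1|] := eqVneq (triple q).1.1; last by rewrite mulr0 !mul0r.
have [e2|] := eqVneq (triple q).1.2; last by rewrite mulr0 !mul0r.
have [e3|] := eqVneq (triple q).2; last by rewrite mulr0.
by move: qq'; rewrite [q']tripleP [q in X in _ != X]tripleP e1 e2 e3 eqxx.
Qed.

Lemma tensor_rank_le (T : tensor F m1 m2 m3) k : (tensor_rank T <= k)%N <-> rank_set k T.
Proof.
have [Tr Tmin] := tensor_rankP T; split=> [rk|]; last exact: Tmin.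
exact: rank_set_le Tr.
Qed.

End RankSets.

Lemma bigmin_le n (r : 'I_n.+1 -> nat) i : (\big[minn/r ord0]_j r j <= r i)%N.
Proof.
have : i \in index_enum 'I_n.+1 by rewrite mem_index_enum.
elim: (index_enum _) => // j s IHs; rewrite inE big_cons => /predU1P[->|/IHs].
  exact: geq_minl.
exact/leq_trans/geq_minr.
Qed.

Section RealRank.
Variables (R : realType) (m1 m2 m3 : nat).
Local Notation N := (m1 * m2 * m3)%N.
Local Notation rank_set k := (range (@rank_one_sum R m1 m2 m3 k)).
Local Notation rpoly k := (@rank_poly m1 m2 m3 k R).

Lemma rank_setP k T :
  rank_set k T <-> exists w : 'rV_(k * (m1 + m2 + m3)), forall q, peval (rpoly k q) w = T 0 q.
Proof.
split=> [[x _ <-]|[w wT]].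
  have [w <-] := unpack_surj x; exists w => q; exact: meval_rank_poly.
by exists (unpack w) => //; apply/rowP => q; rewrite -meval_rank_poly; exact: wT.
Qed.

Lemma sa_rank_set k : sa (rank_set k).
Proof.
have pid := @polymap_id R (N + k * (m1 + m2 + m3)).
have sB : sa [set z : 'rV[R]_(N + k * (m1 + m2 + m3)) |
    forall q, peval (rpoly k q) (rsubmx z) = lsubmx z 0 q].
  apply: sa_forall => q; apply: sa_eq; last exact: polymap_lsubmx.
  exact: polyfun_comp (polyfun_peval _) (polymap_rsubmx pid).
apply: (sa_ext (sa_proj sB)) => T; rewrite rank_setP.
by split=> -[w wT]; exists w => q; have := wT q; rewrite row_mxKl row_mxKr.
Qed.

Local Notation C := R[i].
Local Notation phi := (real_complex R).

(** If the Jacobian of the parametrisation were degenerate at all real points, a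
    nonzero polynomial would vanish on all tensors of rank at most k, hence on O. *)
Lemma grank_le_of_interior k (O : set (tensor R m1 m2 m3)) :
  (0 < m1)%N -> (0 < m2)%N -> (0 < m3)%N ->
  open O -> O !=set0 -> O `<=` rank_set k -> (grank C m1 m2 m3 <= k)%N.
Proof.
move=> m1_gt0 m2_gt0 m3_gt0 oO O0 Ok; have [_ gmin] := grankP C m1_gt0 m2_gt0 m3_gt0.
have [x xf] : exists x, row_free (map_mx (meval x) (jacobian (rpoly k))).
  apply: contrapT => Nx; have [|P P0 PF] := @algebraic_dependence_of_jacobian R _ _ (rpoly k).
    by move=> x; apply/negP => xf; apply: Nx; exists x.
  have [T [OT /eqP PT]] := dense_peval_neq0 P0 O0 oO; apply: PT.
  have /rank_setP[w wT] := Ok _ OT.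
  by rewrite /peval -(meval_eq _ wT) -meval_mcomp PF meval0.
apply: gmin; split.
  rewrite lt0n; apply: contraTneq xf => k0; rewrite /row_free neq_ltn.
  rewrite (leq_ltn_trans (rank_leq_col _)) // k0 mul0n !muln_gt0.
  by rewrite m1_gt0 m2_gt0.
pose w : 'rV[C]_(k * (m1 + m2 + m3)) := \row_u phi (x u).
exists (unpack w); apply/(@row_free_tangent m1 m2 m3 k R C phi).
rewrite (_ : map_mx _ _ = map_mx phi (map_mx (meval x) (jacobian (rpoly k)))).
  by rewrite /row_free mxrank_map.
apply/matrixP => q u; rewrite [LHS]mxE [RHS]mxE [in RHS]mxE /=.
apply: (@mpoly_rmorph_ext _ _ _ (meval (w 0) \o map_mpoly phi) (phi \o meval x)) => [c|i].
  by rewrite /= map_mpolyC !mevalC.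
by rewrite /= map_mpolyX !mevalXU mxE.
Qed.

(** The tangent tensors at some complex point span, so no nonzero polynomial vanishes
    on the tensors of rank at most grank; by genericity these contain an open set. *)
Lemma rank_set_grank_interior (O : set (tensor R m1 m2 m3)) :
  (0 < m1)%N -> (0 < m2)%N -> (0 < m3)%N -> dense O ->
  exists T, O T /\ rank_set (grank C m1 m2 m3) T.
Proof.
move=> m1_gt0 m2_gt0 m3_gt0 dO.
have [[g0 [x xfull]] _] := grankP C m1_gt0 m2_gt0 m3_gt0; set k := grank C m1 m2 m3 in g0 x xfull *.
have [w wx] := unpack_surj x; rewrite -wx in xfull.
have indep := algebraic_independence_of_jacobian ((row_free_tangent phi w).2 xfull).
have [p p0 pE] := sa_generic (sa_rank_set k).
(* A point of the image where [p] does not vanish: [p] composed with the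
   parametrisation is a nonzero polynomial. *)
have [v pv] : exists v, meval v (mmap (@mpolyC _ _) (rpoly k) p) != 0.
  by apply: meval_neq0; apply: contraNneq p0 => /indep ->.
pose T : tensor R m1 m2 m3 := \row_q meval v (rpoly k q).
have ET : rank_set k T.
  apply/rank_setP; exists (\row_u v u) => q; rewrite mxE /peval.
  by apply: meval_eq => u; rewrite mxE.
have pT : peval p T != 0.
  rewrite /peval (meval_eq _ (_ : T 0 =1 fun q => meval v (rpoly k q))).
    by rewrite -meval_mcomp.
  by move=> q; rewrite mxE.
have [S [ES OS]] : (rank_set k)^° `&` O !=set0.
  apply: dO; last exact: open_interior.
  by exists T; apply: filterS (pE _ pT) => y [_]; apply.
by exists S; split=> //; exact: interior_subset ES.
Qed.

Lemma open_translate n (O : set 'rV[R]_n) (t : 'rV[R]_n) :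
  open O -> open [set x | O (x + t)].
Proof.
move=> /open_rowP oO; apply/open_rowP => x /oO[e e0 eO]; exists e => // y xy.
by apply: eO => i; rewrite !mxE opprD addrACA subrr addr0.
Qed.

Lemma dense_open_closure n (O : set 'rV[R]_n) : dense O -> closure O = setT.
Proof.
move=> dO; apply/seteqP; split=> // T _ B BT.
have [|S [BS OS]] := dO B^° _ (@open_interior _ B); first by exists T.
by exists S; split=> //; exact: interior_subset BS.
Qed.

(** Let Y be the union of the sets O_i with r_i < s.  Adding a rank one tensor to a point
    of Y gives a tensor of rank at most s; perturbed into some O_j it has rank r_j <= s,
    so r_j < s since s is not a value.  Hence the closure of Y is stable under the
    addition of rank one tensors, so it is the whole space and every O_i meets Y. *)
Lemma rank_jump (I : Type) (O : I -> set (tensor R m1 m2 m3)) (r : I -> nat) s :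
  (forall i, open (O i)) -> (forall i, O i !=set0) -> dense (\bigcup_i O i) ->
  (forall i T, O i T -> tensor_rank T = r i) ->
  (exists i, (r i < s)%N) -> (forall i, r i <> s) -> forall i, (r i < s)%N.
Proof.
move=> oO O0 dO Or [i0 ri0] rs.
pose Y := [set T | exists2 i, O i T & (r i < s)%N].
have Yadd T t : (exists x y z, t = outer x y z) -> Y T -> closure Y (T + t).
  move=> [x [y [z ->]]] [i OT ri] B BT.
  have [||S [[OS BS] [j _ OjS]]] := dO ([set S | O i (S - outer x y z)] `&` B^°).
  - by exists (T + outer x y z); split=> //=; rewrite addrK.
  - by apply: openI; [exact: open_translate | exact: open_interior].
  exists S; split; last exact: interior_subset BS.
  exists j => //; rewrite ltn_neqAle; apply/andP; split; first exact/eqP.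
  apply: leq_trans ri; rewrite -(Or _ _ OjS) -(Or _ _ OS); apply/tensor_rank_le.
  rewrite -[X in _ X](subrK (outer x y z) S); apply: rank_set_add.
  exact/tensor_rank_le.
have Yclosure T x y z : closure Y T -> closure Y (T + outer x y z).
  move=> YT B /nbhs_interior BT.
  have [|T' [YT' BT']] := YT [set S | B^° (S + outer x y z)].
    apply: open_nbhs_nbhs; split; first exact: open_translate (open_interior _).
    exact: nbhs_singleton BT.
  by apply: (Yadd T' (outer x y z)) => //; exists x, y, z.
have Ysum k S T : rank_set k S -> closure Y T -> closure Y (T + S).
  case=> x _ <-; elim: k x => [|k IHk] x YT.
    by rewrite /rank_one_sum big_ord0 addr0.
  rewrite /rank_one_sum big_ord_recr /= addrA; apply: Yclosure.
  exact: (IHk (fun l => x (widen_ord (leqnSn k) l))).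
have [T0 OT0] := O0 i0.
have YT T : closure Y T.
  rewrite -[T](subrKC T0); apply: (Ysum _ _ _ (rank_set_full (T - T0))).
  by apply: subset_closure; exists i0.
move=> i; have [T OT] := O0 i.
have [|S [[j OjS rj] OS]] := YT T (O i); first by apply: open_nbhs_nbhs; split.
by rewrite -(Or _ _ OS) (Or _ _ OjS).
Qed.

End RealRank.

Theorem theorem7p1 (R : realType) (m1 m2 m3 : nat)
    (m1_gt0 : (0 < m1)%N) (m2_gt0 : (0 < m2)%N) (m3_gt0 : (0 < m3)%N) :
  exists (M : nat) (O : 'I_M.+1 -> set (tensor R m1 m2 m3))
         (r : 'I_M.+1 -> nat),
    (forall i, [/\ O i !=set0, open (O i), connected (O i)
                 & semialgebraic (O i)]) /\
    (forall i j, i != j -> O i `&` O j = set0) /\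
    (let Z := ~` (\bigcup_i O i) in
     [/\ closed Z, semialgebraic Z
       & (sa_dim Z < ((m1 * m2 * m3)%:R : R)%:E)%E]) /\
    (forall i T, O i T -> tensor_rank T = r i) /\
    (\big[minn/r ord0]_i r i)%N = grank R[i] m1 m2 m3 /\
    (let mtrank := (\max_i r i)%N in
     is_least (fun k => closure (range (@rank_one_sum R m1 m2 m3 k)) = setT) mtrank /\
     (forall s : nat, (grank R[i] m1 m2 m3 <= s <= mtrank)%N ->
        exists i, r i = s)).
Proof.
set N := (m1 * m2 * m3)%N.
have N0 : (0 < N)%N by rewrite !muln_gt0 m1_gt0 m2_gt0.
pose E k := range (@rank_one_sum R m1 m2 m3 k).
have genE (k : 'I_N.+1) : exists p : mpoly N R, p != 0 /\
    forall x, peval p x != 0 -> \forall y \near x, E k y <-> E k x.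
  by have [p p0 pP] := sa_generic (sa_rank_set R m1 m2 m3 k); exists p.
pose g k := sval (cid (genE k)).
have g0 k : g k != 0 by have [] := svalP (cid (genE k)).
have gE k x : peval (g k) x != 0 -> \forall y \near x, E k y <-> E k x.
  by have [_] := svalP (cid (genE k)); exact.
pose f := \prod_k g k.
have f0 : f != 0 by apply/prodf_neq0 => k _.
have [I [Q [h [h0 Qp Qdisj Qf Qh]]]] := cell_decomposition f0.
(* E_k is locally constant off the zero set of f, so constant on a cell. *)
have Qrank i x y : Q i x -> Q i y -> tensor_rank x = tensor_rank y.
  have [oQ cQ _] := Qp i.
  have EQ k u v : (k <= N)%N -> Q i u -> Q i v -> E k u -> E k v.
    move=> kN; pose k' : 'I_N.+1 := Ordinal (kN : (k < N.+1)%N).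
    apply: (@locally_constant_connected _ (Q i) (E k) cQ) => z Qz.
    have gz : peval (g k') z != 0.
      by move: (Qf _ _ Qz); rewrite /f (bigD1 k') //= /peval mevalM mulf_eq0 negb_or => /andP[].
    by apply: filterS (gE k' _ gz).
  have le u v : Q i u -> Q i v -> (tensor_rank v <= tensor_rank u)%N.
    move=> Qu Qv; apply/tensor_rank_le; apply: (EQ _ u) => //; last exact/tensor_rank_le.
    exact/tensor_rank_le/rank_set_full.
  by move=> Qx Qy; apply/eqP; rewrite eqn_leq !le.
(* Only the nonempty cells are kept. *)
pose ne := [pred i : I | `[< Q i !=set0 >]].
have [x0 hx0] := meval_neq0 h0.
have [M EM] : exists M, #|ne| = M.+1.
  have [|i Qi] := Qh (\row_i x0 i).
    by rewrite /peval (meval_eq _ (_ : _ =1 x0)) // => i; rewrite mxE.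
  exists #|ne|.-1; rewrite prednK //; apply/card_gt0P; exists i.
  by apply/asboolP; exists (\row_i x0 i).
pose cell (i : 'I_M.+1) : I := enum_val (cast_ord (esym EM) i).
have cell_inj : injective cell by move=> i j /enum_val_inj /cast_ord_inj.
have cell_surj i T : Q i T -> exists j, cell j = i.
  move=> QT; have iP : i \in ne by apply/asboolP; exists T.
  exists (cast_ord EM (enum_rank_in iP i)).
  by rewrite /cell cast_ordK enum_rankK_in.
pose O i := Q (cell i).
have O0 i : O i !=set0 by have := enum_valP (cast_ord (esym EM) i) => /asboolP.
pose r i := tensor_rank (sval (cid (O0 i))).
have rP i T : O i T -> tensor_rank T = r i.
  by move=> OT; apply: (Qrank (cell i)) => //; exact: svalP (cid (O0 i)).
have oO i : open (O i) by have [] := Qp (cell i).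
have hO T : peval h T != 0 -> exists i, O i T.
  by move=> /Qh[i Qi]; have [j ji] := cell_surj _ _ Qi; exists j; rewrite /O ji.
have dO : dense (\bigcup_i O i).
  move=> U U0 oU; have [T [UT /hO[i OT]]] := dense_peval_neq0 h0 U0 oU.
  by exists T; split=> //; exists i.
have Er i T : O i T -> E (r i) T by move=> /rP <-; exact/tensor_rank_le.
have ri_ge i : (grank R[i] m1 m2 m3 <= r i)%N.
  exact: grank_le_of_interior m1_gt0 m2_gt0 m3_gt0 (oO i) (O0 i) (@Er i).
have ri_le : exists i, (r i <= grank R[i] m1 m2 m3)%N.
  have [T [[i _ OT] ET]] := rank_set_grank_interior m1_gt0 m2_gt0 m3_gt0 dO.
  by exists i; rewrite -(rP _ _ OT); exact/tensor_rank_le.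
exists M, O, r; split; [|split; [|split; [|split; [|split]]]].
- by move=> i; have [? ? /sa_semialgebraic ?] := Qp (cell i).
- move=> i j ij; apply/seteqP; split=> // T [Oi Oj].
  by case/eqP: ij; apply: cell_inj; exact: Qdisj Oi Oj.
- split.
  + by apply: open_closedC; apply: bigcup_open => i _.
  + apply: sa_semialgebraic; apply: (@sa_ext _ _ [set T | forall i, ~ O i T]).
      by apply: sa_forall => i; apply: sa_setC; have [] := Qp (cell i).
    by move=> T; split=> [NO [i _ /NO]|NO i OT] //; apply: NO; exists i.
  + apply: (sa_dim_lt h0) => // T NO; apply/eqP; apply: contrapT => /negP /hO[i OT].
    by apply: NO; exists i.
- exact: rP.
- apply/eqP; rewrite eqn_leq; apply/andP; split.
    by have [i ri] := ri_le; exact: leq_trans (bigmin_le r i) ri.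
  by elim/big_ind: _ => // u v gu gv; rewrite leq_min gu.
split.
  split.
    apply/seteqP; split=> // T _; have : closure (\bigcup_i O i) T by rewrite dense_open_closure.
    apply: closure_subset => S [i _ /Er]; apply: rank_set_le; exact: leq_bigmax.
  move=> j Ej; apply/bigmax_leqP => i _; have [T OT] := O0 i.
  have : closure (E j) T by rewrite /E Ej.
  case/(_ (O i)) => [|S [ES OS]]; first by apply: open_nbhs_nbhs; split.
  by rewrite -(rP _ _ OS); exact/tensor_rank_le.
move=> s /andP[gs smt]; apply: contrapT => Ns.
have rs i : r i <> s by move=> ris; apply: Ns; exists i.
have [i0 ri0] := ri_le.
have lts : forall i, (r i < s)%N.
  apply: (rank_jump oO O0 dO rP) => //; exists i0.
  by rewrite ltn_neqAle (leq_trans ri0 gs) andbT; exact/eqP.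
have s0 : (0 < s)%N by exact: leq_ltn_trans (lts i0).
move: smt; rewrite leqNgt -(prednK s0) ltnS => /negP; apply.
by apply/bigmax_leqP => i _; rewrite -ltnS prednK.
Qed.
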